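(* Let $Q\subset\mathbb{P}(\Delta)$ be the $Spin_9$-invariant quadric, where $\Delta$ is the spin representation of $Spin_9$. If $[\delta]\in Q$ and $\delta$ is not a pure spinor, then the zero locus $X_\delta\subset OG(2,9)$ of the section of $\mathcal{S}$ defined by $\delta$ is isomorphic to the $G_2$-horospherical variety.
   Context: Over $\mathbb{C}$. $OG(2,9)$ is the orthogonal Grassmannian of isotropic planes in $V=\mathbb{C}^9$ with a non-degenerate quadratic form. $\Delta$ is the $16$-dimensional spin representation of $Spin_9$, with Clifford action $V\otimes\Delta\to\Delta$. It carries a non-zero $Spin_9$-invariant quadratic form, unique up to scalar, and $Q\subset\mathbb{P}(\Delta)$ is the quadric it defines. The spinor bundle $\mathcal{S}$ on $OG(2,9)$ is the homogeneous bundle of rank $4$ whose fiber at $[U]$ is the cokernel of $U\otimes\Delta\to\Delta$; $H^0(\mathcal{S})=\Delta$, so each $\delta\in\Delta$ defines a section of $\mathcal{S}$. A non-zero spinor $\delta$ is pure if $\{v\in V : v\cdot\delta=0\}$ is a maximal isotropic (i.e. $4$-dimensional) subspace of $V$; the pure spinors form the closed orbit $OG(4,9)\subset Q$. The $G_2$-horospherical variety is the smooth two-orbit-closure type horospherical variety of Picard number one attached to $G_2$: the closure in $\mathbb{P}(V_{\omega_1}\oplus V_{\omega_2})$ of the $G_2$-orbit of $[v_{\omega_1}+v_{\omega_2}]$, where $V_{\omega_1}$ (of dimension $7$) and $V_{\omega_2}=\mathfrak{g}_2$ are the fundamental representations of $G_2$ and $v_{\omega_1},v_{\omega_2}$ are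 highest weight vectors for the same Borel subgroup. It has dimension $7$, and its automorphism group is (locally) $(G_2\times\mathbb{G}_m)\rtimes V_7$, with $V_7=V_{\omega_1}$. *)

(* Defs.v *)
From HB Require Import structures.
From mathcomp Require Import all_boot all_order all_algebra.
From mathcomp Require Import ring mpoly complex reals.

Set Implicit Arguments.
Unset Strict Implicit.
Unset Printing Implicit Defensive.

Import GRing.Theory Num.Theory.
Local Open Scope ring_scope.

(* A subset of the projective space P(F^n) is given by a predicate on 'rV[F]_n,
   read as a predicate on representatives of points: only nonzero vectors
   matter, and x, y represent the same point iff [proj_eq x y]. *)
Section ProjectiveVarieties.
Variable F : numClosedFieldType.

Definition proj_eq n (x y : 'rV[F]_n) : Prop :=
  exists2 c : F, c != 0 & y = c *: x.

Definition zariski_closure n (X : 'rV[F]_n -> Prop) (x : 'rV[F]_n) : Prop :=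
  x != 0 /\
  forall (d : nat) (P : {mpoly F[n]}), P \is d.-homog ->
    (forall y, X y -> P.@[y 0] = 0) -> P.@[x 0] = 0.

Definition poly_map n m (P : 'I_m -> {mpoly F[n]}) (x : 'rV[F]_n) : 'rV[F]_m :=
  \row_j (P j).@[x 0].

(* f is a map on representatives; near each point x of X it agrees, as a map of
   projective spaces, with homogeneous polynomials of a common degree.  The
   nonvanishing locus of P is a neighbourhood of x, and any neighbourhood can be
   reached by multiplying P by a further form.  Compatibility of f with
   [proj_eq] is a consequence. *)
Definition is_morphism n m (X : 'rV[F]_n -> Prop) (Y : 'rV[F]_m -> Prop)
    (f : 'rV[F]_n -> 'rV[F]_m) : Prop :=
  (forall x, X x -> Y (f x)) /\
  (forall x, X x -> exists (d : nat) (P : 'I_m -> {mpoly F[n]}),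
     [/\ forall j, P j \is d.-homog,
         poly_map P x != 0
       & forall y, X y -> poly_map P y != 0 -> proj_eq (f y) (poly_map P y)]).

Definition proj_isomorphic n m
    (X : 'rV[F]_n -> Prop) (Y : 'rV[F]_m -> Prop) : Prop :=
  exists (f : 'rV[F]_n -> 'rV[F]_m) (g : 'rV[F]_m -> 'rV[F]_n),
    [/\ is_morphism X Y f, is_morphism Y X g,
        forall x, X x -> proj_eq x (g (f x))
      & forall y, Y y -> proj_eq y (f (g y))].

End ProjectiveVarieties.

Section Spinors.
Variable F : numClosedFieldType.

(* V = 'rV_9 with the quadratic form v B v^T; Delta = 'cV_16. *)
Definition quad_form (B : 'M[F]_9) (v : 'rV[F]_9) : F := (v *m B *m v^T) 0 0.

Definition nondegenerate_form (B : 'M[F]_9) : Prop :=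
  B^T = B /\ B \in unitmx.

Definition isotropic (B : 'M[F]_9) k (U : 'M[F]_(k, 9)) : Prop :=
  U *m B *m U^T = 0.

(* A 16-dimensional module over the Clifford algebra of V is automatically
   irreducible, and restricts to the spin representation of Spin_9. *)
Definition clifford_action (B : 'M[F]_9)
    (gamma : {linear 'rV[F]_9 -> 'M[F]_16}) : Prop :=
  forall v, gamma v *m gamma v = (quad_form B v)%:M.

Variables (B : 'M[F]_9) (gamma : {linear 'rV[F]_9 -> 'M[F]_16}).

(* The image of Spin_9 in GL(Delta): products of an even number of unit
   vectors. *)
Definition in_spin (g : 'M[F]_16) : Prop :=
  exists s : seq 'rV[F]_9,
    [/\ ~~ odd (size s), forall v, v \in s -> quad_form B v = 1
      & g = \big[mulmx/1%:M]_(v <- s) gamma v].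

Definition invariant_form (K : 'M[F]_16) : Prop :=
  [/\ K^T = K, K != 0 & forall g, in_spin g -> g^T *m K *m g = K].

Definition in_quadric (K : 'M[F]_16) (delta : 'cV[F]_16) : Prop :=
  (delta^T *m K *m delta) 0 0 = 0.

Definition pure_spinor (delta : 'cV[F]_16) : Prop :=
  delta != 0 /\
  exists E : 'M[F]_(4, 9),
    [/\ row_free E, isotropic B E
      & forall v : 'rV[F]_9, gamma v *m delta = 0 <-> (v <= E)%MS].

(* Points of OG(2,9), by a basis (the rows of U). *)
Definition isotropic_plane (U : 'M[F]_(2, 9)) : Prop :=
  row_free U /\ isotropic B U.

(* The image of U (x) Delta -> Delta.  The fibre of the spinor bundle at U is
   Delta modulo this image, and the section defined by delta takes at U the
   value the class of delta. *)
Definition clifford_image (U : 'M[F]_(2, 9)) (delta : 'cV[F]_16) : Prop :=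
  exists a : 'I_2 -> 'cV[F]_16, delta = \sum_i gamma (row i U) *m a i.

(* The bivector u /\ v, as the alternating matrix u^T v - v^T u, in
   'rV_(9 * 9) = V (x) V. *)
Definition plucker (U : 'M[F]_(2, 9)) : 'rV[F]_(9 * 9) :=
  let u := row 0 U in let v := row 1 U in mxvec (u^T *m v - v^T *m u).

(* X_delta as a subvariety, in the Plucker embedding.  Changing the basis of U rescales
   [plucker U] by an arbitrary nonzero scalar. *)
Definition zero_locus (delta : 'cV[F]_16) (p : 'rV[F]_(9 * 9)) : Prop :=
  exists U : 'M[F]_(2, 9),
    [/\ isotropic_plane U, clifford_image U delta & p = plucker U].

End Spinors.

(* G_2 as the Chevalley group acting on its 7-dimensional representation
   (column vectors), with simple roots alpha_0 (short) and alpha_1 (long).  The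
   standard basis consists of weight vectors, of weights (in the basis of
   fundamental weights) (1,0), (-1,1), (2,-1), (0,0), (-2,1), (1,-1), (-1,0). *)
Section G2.
Variable F : numClosedFieldType.

Definition elem7 (a b : nat) : 'M[F]_7 :=
  \matrix_(i, j) ((i == a :> nat) && (j == b :> nat))%:R.

Definition lie7 (x y : 'M[F]_7) : 'M[F]_7 := x *m y - y *m x.

Definition g2_e (i : 'I_2) : 'M[F]_7 :=
  if i == 0 then elem7 0 1 + 2%:R *: elem7 2 3 + elem7 3 4 + elem7 5 6
  else elem7 1 2 + elem7 4 5.

Definition g2_f (i : 'I_2) : 'M[F]_7 :=
  if i == 0 then elem7 1 0 + elem7 3 2 + 2%:R *: elem7 4 3 + elem7 6 5
  else elem7 2 1 + elem7 5 4.

Definition g2_h (i : 'I_2) : 'M[F]_7 := lie7 (g2_e i) (g2_f i).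

Definition g2_cartan (i j : 'I_2) : F :=
  if i == j then 2%:R else if i == 0 then - 3%:R else - 1.

Local Ltac elem7_ring :=
  repeat match goal with |- context [elem7 ?a ?b] =>
    let x := fresh in set x := elem7 a b; move: x => x end;
  apply/matrixP=> ? ?; rewrite !mxE; ring.

(* The defining relations; in finite dimension they imply the Serre relations
   between the g2_e, and between the g2_f. *)
Lemma g2_relations (i j : 'I_2) :
  [/\ lie7 (g2_h 0) (g2_h 1) = 0,
      lie7 (g2_h i) (g2_e j) = g2_cartan i j *: g2_e j,
      lie7 (g2_h i) (g2_f j) = - g2_cartan i j *: g2_f j
    & i != j -> lie7 (g2_e i) (g2_f j) = 0].
Proof.
have elemM a b c d : (b < 7)%N ->
    elem7 a b *m elem7 c d = if b == c then elem7 a d else 0.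
  move=> b7; transitivity ((b == c)%:R *: elem7 a d); last first.
    by case: (b == c); rewrite ?scale1r ?scale0r.
  apply/matrixP=> x y; rewrite !mxE (bigD1 (Ordinal b7)) //= !mxE.
  rewrite big1 => [|k kb]; first by rewrite !eqxx !andbT addr0 -!natrM !mulnb andbCA.
  by rewrite !mxE (_ : (k == b :> nat) = false) ?andbF ?mul0r //; apply: negbTE kb.
have ordE (k : 'I_2) : k = 0 \/ k = 1.
  by case: k => [[|[|]]] // ?; [left | right]; apply/val_inj.
pose expand := (mulmxDl, mulmxDr, mulmxN, mulNmx, =^~ scalemxAl, =^~ scalemxAr).
pose simp := (scale0r, scale1r, scaler0, oppr0, addr0, add0r).
have hE0 : g2_h 0 = elem7 0 0 - elem7 1 1 + 2%:R *: elem7 2 2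
                    - 2%:R *: elem7 4 4 + elem7 5 5 - elem7 6 6.
  rewrite /g2_h /lie7 /g2_e /g2_f /= !expand !elemM //= !simp.
  by elem7_ring.
have hE1 : g2_h 1 = elem7 1 1 - elem7 2 2 + elem7 4 4 - elem7 5 5.
  rewrite /g2_h /lie7 /g2_e /g2_f /= !expand !elemM //= !simp.
  by elem7_ring.
have hhE : lie7 (g2_h 0) (g2_h 1) = 0.
  rewrite hE0 hE1 /lie7.
  rewrite !(mulmxDl, mulNmx) !(mulmxDr, mulmxN) -!(scalemxAl, scalemxAr).
  rewrite !elemM //= !simp.
  by elem7_ring.
case: (ordE i) => ->; case: (ordE j) => ->; split=> // *;
  rewrite ?hE0 ?hE1 /lie7 /g2_e /g2_f /g2_cartan /=;
  rewrite ?(mulmxDl, mulNmx) ?(mulmxDr, mulmxN) -?(scalemxAl, scalemxAr);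
  rewrite ?elemM //= ?simp;
  by elem7_ring.
Qed.

Inductive g2_lie : 'M[F]_7 -> Prop :=
| g2_lie_e i : g2_lie (g2_e i)
| g2_lie_f i : g2_lie (g2_f i)
| g2_lie0 : g2_lie 0
| g2_lieD x y : g2_lie x -> g2_lie y -> g2_lie (x + y)
| g2_lieZ c x : g2_lie x -> g2_lie (c *: x)
| g2_lie_bracket x y : g2_lie x -> g2_lie y -> g2_lie (lie7 x y).

(* The exponential of a nilpotent 7 x 7 matrix. *)
Definition exp_nil (x : 'M[F]_7) : 'M[F]_7 :=
  \sum_(k < 7) (k`!%:R)^-1 *: x ^+ k.

(* The group generated by the root subgroups of the simple roots and of their
   opposites. *)
Inductive g2_group : 'M[F]_7 -> Prop :=
| g2_group1 : g2_group 1%:M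
| g2_group_e i t g : g2_group g -> g2_group (exp_nil (t *: g2_e i) *m g)
| g2_group_f i t g : g2_group g -> g2_group (exp_nil (t *: g2_f i) *m g).

(* Highest weight vectors of V_{omega_1} = F^7 and V_{omega_2} = g_2, both for
   the Borel subgroup of the positive roots. *)
Definition hw_vector_V7 (v : 'cV[F]_7) : Prop :=
  v != 0 /\
  forall i, g2_e i *m v = 0 /\ g2_h i *m v = (i == 0)%:R *: v.

Definition hw_vector_g2 (x : 'M[F]_7) : Prop :=
  [/\ g2_lie x, x != 0
    & forall i, lie7 (g2_e i) x = 0 /\ lie7 (g2_h i) x = (i == 1)%:R *: x].

(* Coordinates on V_{omega_1} (+) V_{omega_2}, as a subspace of
   'cV_7 (+) 'M_7. *)
Definition sum_coord (v : 'cV[F]_7) (x : 'M[F]_7) : 'rV[F]_(7 + 7 * 7) :=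
  row_mx v^T (mxvec x).

Definition g2_orbit (v : 'cV[F]_7) (x : 'M[F]_7) (p : 'rV[F]_(7 + 7 * 7)) : Prop :=
  exists2 g, g2_group g & p = sum_coord (g *m v) (g *m x *m invmx g).

Definition g2_horospherical (v : 'cV[F]_7) (x : 'M[F]_7) :
    'rV[F]_(7 + 7 * 7) -> Prop :=
  zariski_closure (g2_orbit v x).

End G2.

(* Main.v *)
(** A plane [U = <u0, u1>] lies in [X_delta] iff [u0 u1 delta = 0].  As [delta] is isotropic, so is
    the subspace [V delta] of [Delta], hence some [e <> 0] in [V] kills [delta]; as [delta] is not
    pure, [e] is unique up to scalar, and [delta] is a non-isotropic vector of the spin
    representation [ker e] of [V_7 = <e, e'>^perp].  Then [x y delta = <x, y> delta + (x * y) delta]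
    for [x, y] in [V_7] defines the cross product of the octonions, and [X_delta] consists of the
    isotropic planes of [e^perp] whose projection to [V_7] is killed by the cross product.  Its
    linear span is therefore contained in [e /\ V_7 (+) ker (Lambda^2 V_7 -> V_7) = V_7 (+) g_2].

    The same description holds for the horospherical variety in [P (V_7 (+) g_2)]: the equations
    of the planes above hold on the orbit, and conversely [G_2] moves any pair of a nonzero
    isotropic vector [x] and a plane containing it and killed by the cross product to the two
    highest weight vectors, up to scalars which are absorbed by the torus or tend to 0.  So the
    isomorphism is induced by a linear map. *)

Require Import Defs.
From HB Require Import structures.
From mathcomp Require Import all_boot all_order all_algebra.
From mathcomp Require Import ring.
From mathcomp Require Import mpoly complex reals.

Set Implicit Arguments.
Unset Strict Implicit.
Unset Printing Implicit Defensive.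

Import GRing.Theory Num.Theory.
Local Open Scope ring_scope.

(** * Quadratic forms and Clifford modules *)

(** That [V delta] is isotropic rests on Clifford multiplication being self-adjoint for [K], whereas
    [K] is only assumed invariant under products of an even number of unit vectors, which by
    themselves leave a sign open. The sign is decided by the odd dimension 9: the volume element is
    then central. Irreducibility of [Delta] enters only through one rank statement: a subspace
    stable under the Clifford action has dimension divisible by 16. Non-purity enters once, as the
    non-vanishing of the pairing of [delta] with [e' delta]. This makes [x |-> x delta] injective on
    [V_7] and allows division by that pairing when the octonion units are built by Cayley-Dickson
    doubling. The change from octonion units to the weight basis is what makes the planes of
    [X_delta] and the group given by [g2_e], [g2_f] speak of the same form and the same cross
    product. Of that group, only the invariance of both under root subgroups and explicit reductions
    by products of them are used. The closure is handled by explicit equations, so no dimension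
    count or irreducibility of either variety is involved. *)

Section Lin.
Variable F : numClosedFieldType.

Lemma row_base_of_rank m n p (E : 'M[F]_(p, n)) :
  \rank E = m -> exists2 D : 'M[F]_(m, n), row_free D & (D :=: E)%MS.
Proof.
by move=> <-; exists (row_base E); [exact: row_base_free | exact: eq_row_base].
Qed.

(** The rows of [D] span the kernel of [A *m C^T], of dimension [m] because the invertible Gram
    matrix of [C] forces rank [k]. In the basis [col_mx C D] the form is block diagonal, so the last
    claim follows by determinants. *)
Lemma orthogonal_complement k m (C : 'M[F]_(k, k + m)) (A : 'M[F]_(k + m)) :
  A^T = A -> C *m A *m C^T \in unitmx ->
  exists D : 'M[F]_(m, k + m),
    [/\ D *m A *m C^T = 0, col_mx C D \in unitmx
      & A \in unitmx -> D *m A *m D^T \in unitmx].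
Proof.
move=> symA uG.
have rkG : \rank (A *m C^T) = k.
  apply/eqP; rewrite eqn_leq rank_leq_col /=.
  by rewrite -{1}(mxrank_unit uG) -mulmxA mxrankM_maxr.
have rkE : \rank (kermx (A *m C^T)) = m by rewrite mxrank_ker rkG addKn.
have [D freeD eqD] := row_base_of_rank rkE.
have DC : D *m A *m C^T = 0 by rewrite -mulmxA; apply/sub_kermxP; rewrite eqD.
have CD : C *m A *m D^T = 0.
  by apply: trmx_inj; rewrite !trmx_mul trmxK symA mulmxA DC trmx0.
have uP : col_mx C D \in unitmx.
  rewrite -row_free_unit -kermx_eq0; apply/eqP/row_matrixP => i; rewrite row0.
  move: (row i _) (row_sub i (kermx (col_mx C D))) => z /sub_kermxP.
  rewrite -[z]hsubmxK mul_row_col => zP.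
  have z1 : lsubmx z = 0.
    apply: (can_inj (mulmxK uG)); rewrite mul0mx.
    have := congr1 (mulmx^~ (A *m C^T)) zP.
    by rewrite mul0mx mulmxDl -!mulmxA (mulmxA D A) DC mulmx0 addr0 !mulmxA.
  have z2 : rsubmx z = 0.
    apply: (can_inj (mulmxKp freeD)); rewrite mul0mx.
    by rewrite -zP z1 mul0mx add0r.
  by rewrite z1 z2 row_mx0.
exists D; split=> // uA.
have : col_mx C D *m A *m (col_mx C D)^T \in unitmx.
  by rewrite !unitmx_mul uP uA unitmx_tr.
rewrite tr_col_mx mul_col_mx mul_col_row CD DC.
by rewrite !unitmxE det_ublock unitrM => /andP[].
Qed.

Lemma sym_orthonormal n (A : 'M[F]_n) : A^T = A -> A \in unitmx ->
  exists2 P : 'M[F]_n, P \in unitmx & P *m A *m P^T = 1%:M.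
Proof.
elim: n A => [|n IHn] A symA uA.
  by exists 1%:M; rewrite ?unitmx1 // [LHS]flatmx0 [RHS]flatmx0.
(* If all diagonal entries vanish, polarisation supplies the vector: when [A i j != 0], the sum of
   the two basis vectors has value [2 A i j]. *)
have [v qv] : exists v : 'rV[F]_n.+1, (v *m A *m v^T) 0 0 != 0.
  have [/existsP[i qi] | /existsPn qi] := boolP [exists i, A i i != 0].
    by exists (delta_mx 0 i); rewrite -rowE trmx_delta -colE !mxE.
  have [/existsP[i /existsP[j qj]] | /existsPn qj] := boolP [exists i, exists j, A i j != 0].
    exists (delta_mx 0 i + delta_mx 0 j).
    rewrite linearD /= !(mulmxDl, mulmxDr) !trmx_delta -!rowE -!colE !mxE.
    have /negPn/eqP-> := qi i; have /negPn/eqP-> := qi j.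
    have -> : A j i = A i j by rewrite -{1}symA mxE.
    by rewrite addr0 add0r -mulr2n mulrn_eq0.
  move: uA; rewrite (_ : A = 0) ?unitmxE ?det0 ?unitr0 //.
  by apply/matrixP => i j; have /existsPn/(_ j)/negPn/eqP-> := qj i; rewrite mxE.
pose c := sqrtC ((v *m A *m v^T) 0 0).
have c0 : c != 0 by rewrite sqrtC_eq0.
pose w : 'rV[F]_(1 + n) := c^-1 *: v.
have qw : w *m A *m w^T = 1%:M.
  apply/matrixP => i j; rewrite !ord1 /w linearZ /= -!(scalemxAl, scalemxAr) mxE [in LHS]mxE.
  rewrite -[X in _ * (_ * X)]sqrtCK -/c !mxE /=; field.
  exact: c0.
have [|D [DC uP uD]] := @orthogonal_complement 1 n w A symA.
  by rewrite qw unitmx1.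
have [|P uP' P1] := IHn (D *m A *m D^T) _ (uD uA).
  by rewrite !trmx_mul trmxK symA mulmxA.
have DC' : w *m A *m D^T = 0.
  by apply: trmx_inj; rewrite !trmx_mul trmxK symA mulmxA DC trmx0.
have PE : col_mx w (P *m D) *m A *m (col_mx w (P *m D))^T = 1%:M :> 'M_(1 + n).
  rewrite tr_col_mx mul_col_mx mul_col_row qw trmx_mul !mulmxA DC' mul0mx.
  have -> : P *m D *m A *m w^T = 0 by rewrite -!mulmxA (mulmxA D) DC mulmx0.
  by move: P1; rewrite !mulmxA => ->; rewrite -scalar_mx_block.
exists (col_mx w (P *m D)) => //.
have := unitmx1 F n.+1; rewrite -PE -mulmxA.
by rewrite unitmx_mul => /andP[].
Qed.

Lemma orthonormal_complement k m (C : 'M[F]_(k, k + m)) (A : 'M[F]_(k + m)) :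
  A^T = A -> A \in unitmx -> C *m A *m C^T \in unitmx ->
  exists D : 'M[F]_(m, k + m),
    [/\ D *m A *m C^T = 0, col_mx C D \in unitmx & D *m A *m D^T = 1%:M].
Proof.
move=> symA uA uC; have [D [DC uP uD]] := orthogonal_complement symA uC.
have [|P uP' P1] := @sym_orthonormal _ (D *m A *m D^T) _ (uD uA).
  by rewrite !trmx_mul trmxK symA mulmxA.
exists (P *m D); split.
- by rewrite -!mulmxA (mulmxA D) DC mulmx0.
- have -> : col_mx C (P *m D) = block_mx 1%:M 0 0 P *m col_mx C D.
    by rewrite mul_block_col !mul0mx mul1mx addr0 add0r.
  by rewrite unitmx_mul uP andbT unitmxE det_ublock det1 mul1r -unitmxE.
- by rewrite trmx_mul !mulmxA; move: P1; rewrite !mulmxA.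
Qed.

(** The pair acts like fermionic annihilation and creation operators: [N] is the direct sum of [N a]
    and [N b]. The identity [d c d = d], valid for both orders of the pair, bounds each rank by the
    other. *)
Lemma rank_stable_double p n (N : 'M[F]_(p, n)) (a b : 'M[F]_n) :
  a *m a = 0 -> b *m b = 0 -> a *m b + b *m a = 1%:M ->
  (N *m a <= N)%MS -> (N *m b <= N)%MS -> \rank N = (\rank (N *m a) * 2)%N.
Proof.
have half (c d : 'M[F]_n) : d *m d = 0 -> c *m d + d *m c = 1%:M ->
    (N *m d <= N)%MS -> (\rank (N *m d) <= \rank (N *m c))%N.
  move=> dd cd Nd; have dcd : d *m c *m d = d.
    by rewrite -[RHS]mulmx1 -cd mulmxDr !mulmxA dd mul0mx addr0.
  rewrite -[X in N *m X]dcd !mulmxA; apply: leq_trans (mxrankM_maxl _ _) _.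
  exact/mxrankS/submxMr.
move=> aa bb ab Na Nb.
have NE : (N :=: N *m a + N *m b)%MS.
  apply/eqmxP/andP; split; last by rewrite addsmx_sub Na.
  by rewrite -[X in (X <= _)%MS]mulmx1 -ab mulmxDr !mulmxA addrC addmx_sub_adds ?submxMr.
rewrite NE mxrank_disjoint_sum.
  have : \rank (N *m a) = \rank (N *m b).
    by apply/eqP; rewrite eqn_leq !half // addrC.
  by move=> <-; rewrite muln2 addnn.
apply/row_matrixP => i; rewrite row0.
have := row_sub i (N *m a :&: N *m b)%MS; rewrite sub_capmx.
case/andP => /submxP[x xE] /submxP[y yE].
rewrite -[LHS]mulmx1 -ab mulmxDr !mulmxA {1}xE yE.
by rewrite -!mulmxA (mulmxA a) (mulmxA b) aa bb !(mul0mx, mulmx0) addr0.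
Qed.

(** The image [N a_k] is stable under the pairs of smaller index, since these anticommute with
    [a_k]; so each pair halves the rank once more. *)
Lemma rank_stable_clifford k p n (N : 'M[F]_(p, n)) (a b : nat -> 'M[F]_n) :
  (forall i, (i < k)%N ->
     [/\ a i *m a i = 0, b i *m b i = 0 & a i *m b i + b i *m a i = 1%:M]) ->
  (forall i j, (j < i < k)%N ->
     a i *m a j = - (a j *m a i) /\ a i *m b j = - (b j *m a i)) ->
  (forall i, (i < k)%N -> (N *m a i <= N)%MS /\ (N *m b i <= N)%MS) ->
  (2 ^ k %| \rank N)%N.
Proof.
elim: k => [|k IHk] in p N * => ab anti stN; first exact: dvd1n.
have [aa bb ab1] := ab k (ltnSn k); have [Na Nb] := stN k (ltnSn k).
rewrite (rank_stable_double aa bb ab1 Na Nb) expnSr dvdn_pmul2r //.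
apply: IHk => [i ik|i j /andP[ji ik]|i ik].
- exact/ab/ltnW.
- by apply: anti; rewrite ji ltnW.
- have [anta antb] := anti k i ltac:(by rewrite ik /=).
  have [Nai Nbi] := stN i (ltnW ik).
  by rewrite -!mulmxA anta antb !mulmxN !eqmx_opp !mulmxA !submxMr.
Qed.

End Lin.

Section Bilinear.
Variable F : numClosedFieldType.

Definition bil n (A : 'M[F]_n) (u v : 'rV[F]_n) : F := (u *m A *m v^T) 0 0.

Variables (n : nat) (A : 'M[F]_n).

Lemma bilDl u u' v : bil A (u + u') v = bil A u v + bil A u' v.
Proof. by rewrite /bil !mulmxDl mxE. Qed.

Lemma bilDr u v v' : bil A u (v + v') = bil A u v + bil A u v'.
Proof. by rewrite /bil linearD mulmxDr mxE. Qed.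

Lemma bilZl c u v : bil A (c *: u) v = c * bil A u v.
Proof. by rewrite /bil -!scalemxAl mxE. Qed.

Lemma bilZr c u v : bil A u (c *: v) = c * bil A u v.
Proof. by rewrite /bil linearZ -scalemxAr mxE. Qed.

Lemma bilNl u v : bil A (- u) v = - bil A u v.
Proof. by rewrite -scaleN1r bilZl mulN1r. Qed.

Lemma bilNr u v : bil A u (- v) = - bil A u v.
Proof. by rewrite -scaleN1r bilZr mulN1r. Qed.

Lemma bil0l v : bil A 0 v = 0.
Proof. by rewrite /bil !mul0mx mxE. Qed.

Lemma bil0r v : bil A v 0 = 0.
Proof. by rewrite /bil trmx0 mulmx0 mxE. Qed.

Lemma bilC u v : A^T = A -> bil A u v = bil A v u.
Proof.
move=> symA; rewrite /bil; have <- : (v *m A *m u^T)^T = u *m A *m v^T.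
  by rewrite !trmx_mul trmxK symA mulmxA.
by rewrite mxE.
Qed.

Lemma mulmx_bil k l (U : 'M[F]_(k, n)) (V : 'M[F]_(l, n)) i j :
  (U *m A *m V^T) i j = bil A (row i U) (row j V).
Proof. by rewrite /bil -row_mul !mxE; apply: eq_bigr => h _; rewrite !mxE. Qed.

End Bilinear.

(** * Clifford modules of rank 16: stable subspaces and adjoints *)

Section Clifford.
Variables (F : numClosedFieldType) (B : 'M[F]_9).
Hypotheses (symB : B^T = B) (uB : B \in unitmx).
Variable g : 'rV[F]_9 -> 'M[F]_16.
Hypotheses (gD : forall u v, g (u + v) = g u + g v) (gZ : forall c u, g (c *: u) = c *: g u).
Hypothesis gE : forall v, g v *m g v = (bil B v v)%:M.

Lemma clifford_map0 : g 0 = 0.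
Proof. by rewrite -(scale0r (0 : 'rV[F]_9)) gZ scale0r. Qed.

Lemma clifford_mapN u : g (- u) = - g u.
Proof. by rewrite -!scaleN1r gZ. Qed.

Lemma clifford_map_sum I (r : seq I) (P : pred I) (f : I -> 'rV[F]_9) :
  g (\sum_(i <- r | P i) f i) = \sum_(i <- r | P i) g (f i).
Proof. exact: (big_morph _ gD clifford_map0). Qed.

Lemma clifford_anticommutator u v : g u *m g v + g v *m g u = (2%:R * bil B u v)%:M.
Proof.
have := gE (u + v); rewrite gD !(mulmxDl, mulmxDr) !gE !(bilDl, bilDr) (bilC v u symB).
rewrite !raddfD /= => /eqP; rewrite -subr_eq0 => /eqP E.
apply/eqP; rewrite -subr_eq0 -[X in _ == X]E; apply/eqP/matrixP => i j.
by rewrite !mxE; case: (i == j); rewrite ?(mulr1n, mulr0n); ring.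
Qed.

Lemma clifford_anticomm u v : g u *m g v = (2%:R * bil B u v)%:M - g v *m g u.
Proof. by rewrite -clifford_anticommutator addrK. Qed.

Lemma clifford_swap u v (z : 'cV[F]_16) : g u *m (g v *m z) =
  (2%:R * bil B u v) *: z - g v *m (g u *m z).
Proof. by rewrite !mulmxA clifford_anticomm mulmxBl mul_scalar_mx. Qed.

Lemma clifford_square u (z : 'cV[F]_16) : g u *m (g u *m z) = bil B u u *: z.
Proof. by rewrite mulmxA gE mul_scalar_mx. Qed.

Lemma orthonormal_vectors : exists2 r : nat -> 'rV[F]_9,
  forall i j, (i < 9)%N -> (j < 9)%N -> bil B (r i) (r j) = (i == j)%:R
  & forall v, exists c : 'I_9 -> F, v = \sum_i c i *: r i.
Proof.
have [P uP PP] := sym_orthonormal symB uB.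
exists (fun i => row (inord i) P) => [i j i9 j9|v].
  by rewrite -mulmx_bil PP mxE -val_eqE /= !inordK.
exists ((v *m invmx P) 0); rewrite -{1}(mulmxKV uP v) mulmx_sum_row.
by apply: eq_bigr => i _; rewrite inord_val.
Qed.

(* The 9 coordinates contain 4 orthogonal hyperbolic planes, each of which halves the rank. *)
Lemma rank_clifford_stable p (N : 'M[F]_(p, 16)) :
  (forall v, (N *m (g v)^T <= N)%MS) -> (16 %| \rank N)%N.
Proof.
move=> stN; have [r rr _] := orthonormal_vectors.
(* Isotropic vectors of a hyperbolic plane; the factor 1/2 gives [2 * bil B (al k) (be k) = 1], as
   the halving requires. The operators are transposed below because ranks are those of row
   spaces. *)
pose al k := 2%:R^-1 *: (r k.*2 + 'i *: r k.*2.+1).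
pose be k := 2%:R^-1 *: (r k.*2 - 'i *: r k.*2.+1).
have ii : 'i * 'i = -1 :> F by rewrite -expr2 sqrCi.
have lt1 k : (k < 4)%N -> (k.*2 < 9)%N by case: k => [|[|[|[|k]]]].
have lt2 k : (k < 4)%N -> (k.*2.+1 < 9)%N.
  by case: k => [|[|[|[|k]]]].
have neq (i j : nat) : ((i.*2 == j.*2.+1) = false) * ((i.*2.+1 == j.*2) = false).
  by split; apply/negP => /eqP/(congr1 odd); rewrite /= !odd_double.
have bilE i j : (i < 4)%N -> (j < 4)%N ->
  [/\ bil B (al i) (al j) = 0, bil B (be i) (be j) = 0
    & bil B (al i) (be j) = 2%:R^-1 * (i == j)%:R].
  move=> i4 j4; rewrite /al /be.
  rewrite !(bilZl, bilZr, bilDl, bilDr, bilNl, bilNr) !rr ?lt1 ?lt2 //.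
  rewrite !neq -[(_.*2.+1 == _)%N]/(i.*2 == j.*2) -!muln2 eqn_pmul2r // !mulr0n.
  split.
  - transitivity (2%:R^-1 * 2%:R^-1 * (i == j)%:R * (1 + 'i * 'i) : F); first by ring.
    by rewrite ii; ring.
  - transitivity (2%:R^-1 * 2%:R^-1 * (i == j)%:R * (1 + 'i * 'i) : F); first by ring.
    by rewrite ii; ring.
  - transitivity (2%:R^-1 * 2%:R^-1 * (i == j)%:R * (1 - 'i * 'i) : F); first by ring.
    by rewrite ii; field.
have anti u v : (g u)^T *m (g v)^T =
    (2%:R * bil B u v)%:M - (g v)^T *m (g u)^T.
  by rewrite -!trmx_mul [in LHS]clifford_anticomm (bilC v u symB) linearB /= tr_scalar_mx.
pose a k := (g (al k))^T; pose b k := (g (be k))^T.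
apply: (@rank_stable_clifford F 4 p 16 N a b) => [i i4|i j /andP[ji i4]|i i4].
- have [aa bb ab] := bilE i i i4 i4.
  split; try by rewrite -trmx_mul gE ?aa ?bb raddf0 trmx0.
  by rewrite anti subrK ab eqxx mulr1 divff ?pnatr_eq0.
- have j4 := ltn_trans ji i4; have [aa bb ab] := bilE i j i4 j4.
  by split; rewrite [LHS]anti ?aa ?ab ?(gtn_eqF ji) !mulr0 raddf0 sub0r.
- by split; apply: stN.
Qed.

(** Schur's lemma by ranks: the images of [w - 1] and [w + 1] are stable under the Clifford action,
    so each has rank 0 or 16, and the two ranks add up to at most 16 because the product
    vanishes. *)
Lemma sq1_scalar_of_comm (w : 'M[F]_16) :
  w *m w = 1%:M -> (forall v, w *m g v = g v *m w) ->
  w = 1%:M \/ w = - 1%:M.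
Proof.
move=> ww wC.
have dvd c : (16 %| \rank (w - c%:M)%R)%N.
  rewrite -mxrank_tr; apply: rank_clifford_stable => v.
  rewrite -trmx_mul mulmxBr -wC mul_mx_scalar -mul_scalar_mx -mulmxBl trmx_mul.
  exact: submxMl.
have w0 : (w - 1%:M) *m (w - (-1)%:M) = 0.
  rewrite raddfN /= opprK mulmxDr mulmxBl ww mulmx1 mul1mx.
  by rewrite addrC addrA subrK subrr.
have := mulmx0_rank_max w0.
have rk0 c : (\rank (w - c%:M)%R < 16)%N -> w = c%:M.
  move=> lt16; apply/eqP; rewrite -subr_eq0 -mxrank_eq0.
  by case: (posnP (\rank (w - c%:M)%R)) => [//|/dvdn_leq/(_ (dvd c))]; rewrite leqNgt lt16.
have [lt1 _|ge1] := ltnP (\rank (w - 1%:M)%R) 16; first by left; apply: rk0.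
rewrite -[X in (_ <= X)%N]add0n => le; right; rewrite -raddfN; apply: rk0.
apply: leq_trans (isT : 1 <= 16)%N; rewrite ltnS -(leq_add2l 16).
by apply: leq_trans le; rewrite leq_add2r.
Qed.

Variable K : 'M[F]_16.
Hypotheses (symK : K^T = K) (K0 : K != 0).
Hypothesis spinK : forall u v, bil B u u = 1 -> bil B v v = 1 ->
  (g u *m g v)^T *m K *m (g u *m g v) = K.

(* [K' = g v^T K g v] does not depend on the unit vector [v], and [K - K'] anticommutes with all
   [g v]; so the volume element, which is the scalar 1 or -1, sends [K - K'] to its opposite. *)
Lemma invariant_form_adjoint v : (g v)^T *m K = K *m g v.
Proof.
have [r rr r_span] := orthonormal_vectors.
pose c (i : nat) := g (r i).
have cc i : (i < 9)%N -> c i *m c i = 1%:M.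
  by move=> i9; rewrite gE rr // eqxx.
have cC i j : (i < 9)%N -> (j < 9)%N -> i != j -> c i *m c j = - (c j *m c i).
  by move=> i9 j9 /negPf ij; rewrite clifford_anticomm rr // ij mulr0 raddf0 sub0r.
have cK i j : (i < 9)%N -> (j < 9)%N ->
    (c i)^T *m K *m c i = (c j)^T *m K *m c j.
  move=> i9 j9; have := spinK (u := r i) (v := r j); rewrite !rr // !eqxx => /(_ erefl erefl).
  rewrite trmx_mul => E.
  have := congr1 (fun M => (c j)^T *m M *m c j) E.
  rewrite !mulmxA -trmx_mul cc // trmx1 mul1mx => <-.
  by rewrite -!mulmxA cc // mulmx1.
have c_span u : exists f : 'I_9 -> F, g u = \sum_i f i *: c i.
  have [f ->] := r_span u; exists f; rewrite clifford_map_sum.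
  by apply: eq_bigr => i _; rewrite gZ.
clearbody c.
pose K' := (c 0%N)^T *m K *m c 0%N.
pose L := K - K'.
have LC i : (i < 9)%N -> (c i)^T *m L = - (L *m c i).
  move=> i9; rewrite /L {1}/K' (cK 0%N i) // mulmxBr mulmxBl opprB.
  rewrite !mulmxA -trmx_mul cc // trmx1 mul1mx; congr (_ - _).
  by rewrite /K' (cK 0%N i) // -!mulmxA cc // mulmx1.
pose pr s := foldr (fun i M => c i *m M) 1%:M s.
have pr_swap s j : all (fun i => i < 9)%N s -> (j < 9)%N ->
    pr s *m c j = (-1) ^+ count (predC1 j) s *: (c j *m pr s).
  elim: s => [_ _|x s IHs /= /andP[x9 s9] j9]; first by rewrite /= scale1r mulmx1 mul1mx.
  rewrite -mulmxA IHs // -scalemxAr mulmxA; have [->|xj] := eqVneq x j.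
    by rewrite add0n mulmxA.
  rewrite (cC j x) 1?eq_sym // exprD [(-1) ^+ nat_of_bool _]expr1 mulN1r scaleNr.
  by rewrite mulNmx scalerN opprK mulmxA.
have pr_rcons s x : pr (rcons s x) = pr s *m c x.
  by elim: s => [|y s /= ->]; rewrite /= ?mulmx1 ?mul1mx ?mulmxA.
have pr_rev s : uniq s -> all (fun i => i < 9)%N s ->
    pr (rev s) = (-1) ^+ 'C(size s, 2) *: pr s.
  elim: s => [|x s IHs] /=; first by rewrite scale1r.
  case/andP => xs us /andP[x9 s9]; rewrite rev_cons pr_rcons IHs // -scalemxAl pr_swap //.
  have /eqP-> : count (predC1 x) s == size s.
    by rewrite -all_count; apply/allP => y; apply: contraTneq => ->.
  by rewrite scalerA binS bin1 exprD.
have pr_mul_rev s : all (fun i => i < 9)%N s -> pr s *m pr (rev s) = 1%:M.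
  elim: s => [_|x s IHs /= /andP[x9 s9]]; first by rewrite mulmx1.
  by rewrite rev_cons pr_rcons -mulmxA (mulmxA (pr s)) IHs // mul1mx cc.
have pr_adj s : all (fun i => i < 9)%N s -> (pr s)^T *m L = (-1) ^+ size s *: (L *m pr (rev s)).
  elim: s => [_|x s IHs /= /andP[x9 s9]]; first by rewrite trmx1 mul1mx mulmx1 scale1r.
  rewrite trmx_mul -mulmxA LC // mulmxN mulmxA IHs // -scalemxAl -scalerN -mulmxA.
  by rewrite -pr_rcons -rev_cons exprSr mulrN1 scaleNr scalerN.
(* The volume element. Reversal costs the sign of exponent ['C(9, 2) = 36], so [w] is its own
   reversal and squares to 1; it commutes with [c i], which passes 8 other factors; its odd length
   gives [w^T L = - L w]. *)
pose w := pr (iota 0 9).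
have w_rev : pr (rev (iota 0 9)) = w by rewrite pr_rev // -signr_odd scale1r.
have ww : w *m w = 1%:M by rewrite -{2}w_rev pr_mul_rev.
have wC u : w *m g u = g u *m w.
  have [f ->] := c_span u; rewrite mulmx_sumr mulmx_suml.
  apply: eq_bigr => i _; rewrite -scalemxAr -scalemxAl (pr_swap (iota 0 9) i isT (ltn_ord i)).
  suff /eqP-> : count (predC1 (i : nat)) (iota 0 9) == 8%N by rewrite -signr_odd scale1r.
  by case: i => [[|[|[|[|[|[|[|[|[|]]]]]]]]]].
have wL : w^T *m L = - (L *m w) by rewrite (pr_adj (iota 0 9) isT) w_rev -signr_odd /= scaleN1r.
have L0 : L = 0.
  suff : L + L = 0.
    by move/eqP; rewrite -mulr2n -scaler_nat scaler_eq0 pnatr_eq0 => /eqP.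
  have := wL; case: (sq1_scalar_of_comm ww wC) => ->.
    by rewrite trmx1 mul1mx mulmx1 => {1}->; rewrite addNr.
  by rewrite raddfN /= trmx1 mulNmx mulmxN mul1mx mulmx1 opprK => {1}<-; rewrite addNr.
have KC i : (i < 9)%N -> (c i)^T *m K = K *m c i.
  have KK' : K = K' by apply/eqP; rewrite -subr_eq0 -/L L0.
  by move=> i9; rewrite [in RHS]KK' /K' (cK 0%N i isT i9) -[RHS]mulmxA (cc i i9) mulmx1.
have [f ->] := c_span v; rewrite linear_sum mulmx_sumr mulmx_suml.
by apply: eq_bigr => i _; rewrite linearZ -scalemxAr -scalemxAl /= KC.
Qed.

(** Self-adjointness makes the radical of [K] stable under the Clifford action, so its dimension is
    0 or 16, and 16 would mean [K = 0]. *)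
Lemma invariant_form_unit : K \in unitmx.
Proof.
rewrite -row_free_unit -kermx_eq0 -mxrank_eq0.
have dvd : (16 %| \rank (kermx K))%N.
  apply: rank_clifford_stable => v; apply/sub_kermxP.
  by rewrite -mulmxA invariant_form_adjoint mulmxA mulmx_ker mul0mx.
case: (posnP (\rank (kermx K))) => [//|rk0].
have := dvdn_leq rk0 dvd; rewrite mxrank_ker.
case: (\rank K) (mxrank_eq0 K) => [|n] rkK; first by move: K0; rewrite -rkK eqxx.
by rewrite subSS => /leq_trans/(_ (leq_subr _ _)).
Qed.

End Clifford.

(** * Octonions and the weight basis of V_7 *)

Section SevenCoordinates.
Variable F : numClosedFieldType.

Definition o7 (k : nat) : 'I_7 := inord k.

Lemma o7E k : (k < 7)%N -> o7 k = k :> nat.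
Proof. exact: inordK. Qed.

Lemma ord7P (P : 'I_7 -> Prop) :
  P (o7 0) -> P (o7 1) -> P (o7 2) -> P (o7 3) -> P (o7 4) -> P (o7 5) -> P (o7 6) ->
  forall i, P i.
Proof.
move=> h0 h1 h2 h3 h4 h5 h6 k; rewrite -[k]inord_val.
by case: k => [[|[|[|[|[|[|[|//]]]]]]]].
Qed.

Lemma sum7 (V : nmodType) (f : 'I_7 -> V) :
  \sum_i f i = f (o7 0) + f (o7 1) + f (o7 2) + f (o7 3) + f (o7 4) + f (o7 5) + f (o7 6).
Proof.
rewrite !big_ord_recr big_ord0 /= add0r; do !congr (_ + _); congr f;
  by apply/val_inj; rewrite /= inordK.
Qed.

(* Lists shorter than 7 are padded with zeros. *)
Definition row7 (s : seq F) : 'rV[F]_7 := \row_k nth 0 s k.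

Lemma row7E s k : (k < 7)%N -> row7 s 0 (o7 k) = nth 0 s k.
Proof. by move=> k7; rewrite mxE o7E. Qed.

Definition wedge n (x y : 'rV[F]_n) : 'M[F]_n := x^T *m y - y^T *m x.

Lemma wedgeE n (x y : 'rV[F]_n) i j : wedge x y i j = x 0 i * y 0 j - y 0 i * x 0 j.
Proof. by rewrite !mxE !big_ord1 !mxE. Qed.

(* The cross product of V_7 in the weight basis, as a linear map on bivectors. *)
Definition cross7 (w : 'M[F]_7) : 'rV[F]_7 :=
  let c i j := w (o7 i) (o7 j) in
  row7 [:: c 1%N 2%N - c 0%N 3%N; c 1%N 3%N - c 0%N 4%N; c 2%N 3%N - c 0%N 5%N;
           2%:R^-1 * (c 2%N 4%N - c 0%N 6%N - c 1%N 5%N);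
           c 3%N 4%N - c 1%N 6%N; c 3%N 5%N - c 2%N 6%N; c 4%N 5%N - c 3%N 6%N].

(** The invariant form of the 7-dimensional representation: it pairs opposite weights, and the [- 2]
    on the zero weight vector matches the coefficients 2 in [g2_e] and [g2_f]. *)
Definition form7 : 'M[F]_7 :=
  \matrix_i row7 (nth [::]
    [:: [:: 0; 0; 0; 0; 0; 0; 1]; [:: 0; 0; 0; 0; 0; -1]; [:: 0; 0; 0; 0; 1];
        [:: 0; 0; 0; - 2%:R]; [:: 0; 0; 1]; [:: 0; -1]; [:: 1]] i).

Lemma form7_bil (x y : 'rV[F]_7) : (x *m form7 *m y^T) 0 0 =
  let X k := x 0 (o7 k) in let Y k := y 0 (o7 k) in
  X 0%N * Y 6%N + X 6%N * Y 0%N - X 1%N * Y 5%N - X 5%N * Y 1%N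
  + X 2%N * Y 4%N + X 4%N * Y 2%N - 2%:R * X 3%N * Y 3%N.
Proof.
have fE i j : (i < 7)%N -> (j < 7)%N -> form7 (o7 i) (o7 j) = nth 0 (nth [::]
    [:: [:: 0; 0; 0; 0; 0; 0; 1]; [:: 0; 0; 0; 0; 0; -1]; [:: 0; 0; 0; 0; 1];
        [:: 0; 0; 0; - 2%:R]; [:: 0; 0; 1]; [:: 0; -1]; [:: 1]] i) j.
  by move=> i7 j7; rewrite !mxE !o7E.
rewrite mxE sum7 !mxE !sum7 !fE //=.
ring.
Qed.

Lemma form7_sym : form7^T = form7.
Proof.
apply/matrixP; elim/ord7P; elim/ord7P; by rewrite !mxE !o7E.
Qed.

Lemma form7_unit : form7 \in unitmx.
Proof.
rewrite -row_free_unit -kermx_eq0; apply/eqP/row_matrixP => i; rewrite row0.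
have /sub_kermxP := row_sub i (kermx form7); move: (row i _) => x xS.
have xS0 (y : 'rV[F]_7) : (x *m form7 *m y^T) 0 0 = 0 by rewrite xS mul0mx mxE.
apply/rowP => j; rewrite [RHS]mxE; move: j.
elim/ord7P.
- by have := xS0 (delta_mx 0 (o7 6)); rewrite form7_bil /= !mxE -!val_eqE /= !o7E //= => <-; ring.
- by have := xS0 (- delta_mx 0 (o7 5)); rewrite form7_bil /= !mxE -!val_eqE /= !o7E //= => <-; ring.
- by have := xS0 (delta_mx 0 (o7 4)); rewrite form7_bil /= !mxE -!val_eqE /= !o7E //= => <-; ring.
- have := xS0 (- 2%:R^-1 *: delta_mx 0 (o7 3)).
  by rewrite form7_bil /= !mxE -!val_eqE /= !o7E //= => <-; field.
- by have := xS0 (delta_mx 0 (o7 2)); rewrite form7_bil /= !mxE -!val_eqE /= !o7E //= => <-; ring.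
- by have := xS0 (- delta_mx 0 (o7 1)); rewrite form7_bil /= !mxE -!val_eqE /= !o7E //= => <-; ring.
- by have := xS0 (delta_mx 0 (o7 0)); rewrite form7_bil /= !mxE -!val_eqE /= !o7E //= => <-; ring.
Qed.

(** Units 0, 1, 2 are quaternion units, 3 is the doubling unit, and 4, 5, 6 are the products of 0,
    1, 2 with it. Each coordinate collects the three lines of the Fano plane through that unit. *)
Definition octonion_cross (x y : 'rV[F]_7) : 'rV[F]_7 :=
  let c a b := x 0 (o7 a) * y 0 (o7 b) - x 0 (o7 b) * y 0 (o7 a) in
  row7 [:: c 1%N 2%N + c 3%N 4%N + c 6%N 5%N; c 2%N 0%N + c 3%N 5%N + c 4%N 6%N;
           c 0%N 1%N + c 3%N 6%N + c 5%N 4%N; c 4%N 0%N + c 5%N 1%N + c 6%N 2%N;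
           c 0%N 3%N + c 6%N 1%N + c 2%N 5%N; c 1%N 3%N + c 0%N 6%N + c 4%N 2%N;
           c 2%N 3%N + c 5%N 0%N + c 1%N 4%N].

(* Octonion units in terms of which the weight basis [l +- i l'] of V_7 is expressed. *)
Definition octonion_basis : 'M[F]_7 :=
  \matrix_i row7 (nth [::]
    [:: [:: 1; 0; 0; 0; 'i; 0; 0]; [:: 0; 0; -1; 0; 0; 0; 'i]; [:: 0; 1; 0; 0; 0; - 'i; 0];
        [:: 0; 0; 0; - 2%:R * 'i]; [:: 0; 1; 0; 0; 0; 'i; 0]; [:: 0; 0; 1; 0; 0; 0; 'i];
        [:: 1; 0; 0; 0; - 'i; 0; 0]] i).

Lemma octonion_basisE (x : 'rV[F]_7) : x *m octonion_basis =
  let X k := x 0 (o7 k) in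
  row7 [:: X 0%N + X 6%N; X 2%N + X 4%N; X 5%N - X 1%N; 'i * (- 2%:R * X 3%N);
           'i * (X 0%N - X 6%N); 'i * (X 4%N - X 2%N); 'i * (X 1%N + X 5%N)].
Proof.
have fE i j : (i < 7)%N -> (j < 7)%N -> octonion_basis (o7 i) (o7 j) = nth 0 (nth [::]
    [:: [:: 1; 0; 0; 0; 'i; 0; 0]; [:: 0; 0; -1; 0; 0; 0; 'i]; [:: 0; 1; 0; 0; 0; - 'i; 0];
        [:: 0; 0; 0; - 2%:R * 'i]; [:: 0; 1; 0; 0; 0; 'i; 0]; [:: 0; 0; 1; 0; 0; 0; 'i];
        [:: 1; 0; 0; 0; - 'i; 0; 0]] i) j.
  by move=> i7 j7; rewrite !mxE !o7E.
by apply/rowP; elim/ord7P; rewrite /= row7E //= mxE sum7 !fE //=; ring.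
Qed.

Let iMi (p q : F) : 'i * p * ('i * q) = - (p * q).
Proof. by rewrite mulrACA -expr2 sqrCi mulN1r. Qed.

(** The factor 2, here and for the cross product below, arises because the combinations [l +- i l']
    are not normalised; it persists in [weight_frame]. *)
Lemma octonion_basis_dot (x y : 'rV[F]_7) :
  (x *m octonion_basis *m (y *m octonion_basis)^T) 0 0 = 2%:R * (x *m form7 *m y^T) 0 0.
Proof.
rewrite !octonion_basisE form7_bil /= mxE sum7 ![_^T _ _]mxE !row7E //= !iMi; ring.
Qed.

Lemma octonion_basis_cross (x y : 'rV[F]_7) :
  octonion_cross (x *m octonion_basis) (y *m octonion_basis) =
  2%:R *: (cross7 (wedge x y) *m octonion_basis).
Proof.
rewrite !octonion_basisE /=; apply/rowP; elim/ord7P;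
  rewrite row7E //= !row7E //= [RHS]mxE row7E //=.
all: by rewrite /cross7 /= ?row7E //= !wedgeE ?iMi; field.
Qed.

Lemma octonion_basis_unit : octonion_basis \in unitmx.
Proof.
rewrite -row_free_unit -kermx_eq0; apply/eqP/row_matrixP => i; rewrite row0.
have /sub_kermxP := row_sub i (kermx octonion_basis); move: (row i _) => x xT.
apply: (can_inj (mulmxK form7_unit)); rewrite mul0mx; apply/rowP => j.
have E : (x *m form7 *m (delta_mx 0 j : 'rV[F]_7)^T) 0 0 = (x *m form7) 0 j.
  by rewrite trmx_delta -colE mxE.
have := octonion_basis_dot x (delta_mx 0 j); rewrite E xT mul0mx mxE => /esym/eqP.
by rewrite mulf_eq0 pnatr_eq0 /= => /eqP->; rewrite mxE.
Qed.

End SevenCoordinates.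

(** * A frame adapted to the spinor *)

Section Frame.
Variables (F : numClosedFieldType) (B : 'M[F]_9).
Hypotheses (symB : B^T = B) (uB : B \in unitmx).
Variable g : 'rV[F]_9 -> 'M[F]_16.
Hypotheses (gD : forall u v, g (u + v) = g u + g v) (gZ : forall c u, g (c *: u) = c *: g u).
Hypothesis gE : forall v, g v *m g v = (bil B v v)%:M.
Variable K : 'M[F]_16.
Hypotheses (symK : K^T = K) (uK : K \in unitmx).
Hypothesis adjK : forall v, (g v)^T *m K = K *m g v.

Let g_swap u v (z : 'cV[F]_16) := clifford_swap symB gD gE u v z.
Let g_g u (z : 'cV[F]_16) := clifford_square gE u z.
Let gN := clifford_mapN gZ.

Definition spinor_form (z w : 'cV[F]_16) := bil K z^T w^T.
Local Notation kf := spinor_form.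

Lemma spinor_formC z w : kf z w = kf w z.
Proof. exact: bilC. Qed.
Lemma spinor_formDr z w w' : kf z (w + w') = kf z w + kf z w'.
Proof. by rewrite /kf linearD bilDr. Qed.
Lemma spinor_formZr z c w : kf z (c *: w) = c * kf z w.
Proof. by rewrite /kf linearZ bilZr. Qed.
Lemma spinor_formNr z w : kf z (- w) = - kf z w.
Proof. by rewrite -scaleN1r spinor_formZr mulN1r. Qed.
Lemma spinor_form0r z : kf z 0 = 0.
Proof. by rewrite /kf trmx0 bil0r. Qed.
Lemma spinor_form_adj u z w : kf (g u *m z) w = kf z (g u *m w).
Proof.
by rewrite /kf /bil !trmxK trmx_mul -(mulmxA _ _ K) adjK !mulmxA.
Qed.

Lemma eq0_of_double (x : F) : x + x = 0 -> x = 0.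
Proof. by move/eqP; rewrite -mulr2n mulrn_eq0 => /eqP. Qed.

Definition spinor_orbit_mx (z : 'cV[F]_16) : 'M[F]_(9, 16) :=
  \matrix_(i, j) (g (delta_mx 0 i) *m z) j 0.

Lemma spinor_orbit_mxE v z : v *m spinor_orbit_mx z = (g v *m z)^T.
Proof.
rewrite {2}(row_sum_delta v) (clifford_map_sum gD gZ) mulmx_suml; apply/rowP => j.
rewrite !mxE summxE; apply: eq_bigr => i _.
by rewrite gZ -scalemxAl !mxE.
Qed.

Variable d : 'cV[F]_16.
Hypotheses (d0 : d != 0) (dQ : kf d d = 0).

(** Self-adjointness makes the left side symmetric in [u] and [v], while the Clifford relation makes
    it antisymmetric up to a multiple of [kf d d = 0]. *)
Lemma spinor_form_isotropic u v : kf d (g u *m (g v *m d)) = 0.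
Proof.
apply: eq0_of_double; rewrite -{1}spinor_form_adj spinor_formC spinor_form_adj (g_swap v u).
rewrite spinor_formDr spinor_formNr.
by rewrite spinor_formZr dQ mulr0 add0r addNr.
Qed.

(* [V d] is totally isotropic in the 16-dimensional [Delta], so [V -> V d] is not injective. *)
Lemma exists_annihilator : exists2 e, e != 0 & g e *m d = 0.
Proof.
have PhiK : spinor_orbit_mx d *m (K *m (spinor_orbit_mx d)^T) = 0.
  apply/matrixP => i j; rewrite mulmxA mulmx_bil mxE !rowE !spinor_orbit_mxE.
  by rewrite -/(kf _ _) spinor_form_adj spinor_form_isotropic.
have := mulmx0_rank_max PhiK.
rewrite eqmxMfull ?row_full_unit // mxrank_tr addnn => rk.
have : kermx (spinor_orbit_mx d) != 0.
  rewrite kermx_eq0 /row_free; apply: contraTneq rk => ->; by [].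
case/rowV0Pn => e /sub_kermxP; rewrite spinor_orbit_mxE => ed e0; exists e => //.
by rewrite -[LHS]trmxK ed trmx0.
Qed.

Lemma annihilator_isotropic u v : g u *m d = 0 -> g v *m d = 0 -> bil B u v = 0.
Proof.
move=> ud vd; have := g_swap u v d; rewrite ud vd !mulmx0 subr0 => /esym/eqP.
by rewrite scaler_eq0 (negPf d0) orbF mulf_eq0 pnatr_eq0 => /eqP.
Qed.

(** The value 1/2 turns the Clifford relation into [e e' + e' e = 1], so that the kernel and the
    image of [g e] coincide. *)
Lemma exists_dual_isotropic e : e != 0 -> bil B e e = 0 ->
  exists2 e', bil B e' e' = 0 & bil B e e' = 2%:R^-1.
Proof.
move=> e0 ee; have [w ew] : exists w, bil B e w != 0.
  have [/existsP[j ej]|/existsPn ej] := boolP [exists j, (e *m B) 0 j != 0].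
    by exists (delta_mx 0 j); rewrite /bil trmx_delta -colE mxE.
  case/negP: e0; apply/eqP/(can_inj (mulmxK uB)); rewrite mul0mx.
  by apply/rowP => j; have /negPn/eqP-> := ej j; rewrite mxE.
pose w' := (2%:R * bil B e w)^-1 *: w.
have ew' : bil B e w' = 2%:R^-1.
  by rewrite bilZr; field; exact: ew.
clearbody w'; exists (w' - bil B w' w' *: e);
  rewrite !(bilDl, bilDr, bilNl, bilNr, bilZl, bilZr) ee ?ew'.
  by rewrite (bilC w' e symB) ew'; field.
by rewrite mulr0 subr0.
Qed.

Variables e e' : 'rV[F]_9.
Hypotheses (ed : g e *m d = 0) (ee : bil B e e = 0).
Hypotheses (e'e' : bil B e' e' = 0) (ee' : bil B e e' = 2%:R^-1).

Definition in_V7 x := bil B x e = 0 /\ bil B x e' = 0.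

Lemma exists_frame7 : exists N : 'M[F]_(7, 9),
  [/\ N *m B *m N^T = 1%:M, forall a : 'rV_7, in_V7 (a *m N)
    & forall x, in_V7 x -> exists a, x = a *m N].
Proof.
pose C : 'M[F]_(1 + 1, 9) := col_mx e e'.
have CC : C *m B *m C^T = (block_mx 0 2%:R^-1%:M 2%:R^-1%:M 0 : 'M_(1 + 1)).
  have E (u v : 'rV[F]_9) : u *m B *m v^T = (bil B u v)%:M by exact: mx11_scalar.
  by rewrite tr_col_mx mul_col_mx mul_col_row !E ee e'e' (bilC e' e symB) ee' raddf0.
have uC : C *m B *m C^T \in unitmx.
  have E : C *m B *m C^T *m (block_mx 0 2%:R%:M 2%:R%:M 0 : 'M_(1 + 1)) = 1%:M.
    rewrite CC mulmx_block !(mulmx0, mul0mx, add0r, addr0) -!scalar_mxM.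
    by rewrite mulVf ?pnatr_eq0 // -scalar_mx_block.
  by case: (mulmx1_unit E).
have [N [NC uP N1]] := @orthonormal_complement F (1 + 1) 7 C B symB uB uC.
have NCE i : bil B (row i N) e = 0 /\ bil B (row i N) e' = 0.
  move: NC; rewrite tr_col_mx mul_mx_row -[0 in RHS]hsubmxK => /eq_row_mx[].
  rewrite !linear0 => /colP/(_ i) + /colP/(_ i).
  by rewrite !mulmx_bil !mxE !row_id.
exists N; split=> // [a|x [xe xe']].
  by rewrite mulmx_sum_row /in_V7 /bil !mulmx_suml !summxE; split;
    rewrite big1 // => i _; rewrite -!scalemxAl mxE -/(bil B _ _);
    case: (NCE i) => h h'; rewrite ?h ?h' mulr0.
pose z := x *m invmx (col_mx C N).
have xz : x = lsubmx z *m C + rsubmx z *m N by rewrite -mul_row_col hsubmxK mulmxKV.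
have NC0 : rsubmx z *m N *m (B *m C^T) = 0 by rewrite -mulmxA (mulmxA N) NC mulmx0.
have xC : x *m (B *m C^T) = 0.
  rewrite mulmxA tr_col_mx mul_mx_row; apply/rowP => j; rewrite [RHS]mxE.
  rewrite mxE; case: splitP => k _; rewrite ord1 -/(bil B x _) //.
exists (rsubmx z); suff z0 : lsubmx z = 0 by rewrite xz z0 mul0mx add0r.
apply: (can_inj (mulmxK uC)); rewrite mul0mx.
by move: xC; rewrite {1}xz mulmxDl NC0 addr0 !mulmxA.
Qed.

(** The form [K] vanishes on [ker (g e) = im (g e)]; the quadratic form of this 8-dimensional spin
    representation of [V_7] is instead [z |-> kf z (g e' z)], and [c] is its value at [d]. *)
Local Notation c := (kf d (g e' *m d)).

Lemma g_anti u v (z : 'cV[F]_16) : bil B u v = 0 ->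
  g u *m (g v *m z) = - (g v *m (g u *m z)).
Proof. by move=> uv; rewrite g_swap uv mulr0 scale0r sub0r. Qed.

(** By adjointness, and because [e'] anticommutes with [V_7], the left side is symmetric in [x] and
    [y]; the Clifford relation then computes it. So [x |-> x d] is a similitude onto its image as
    soon as [c] is nonzero. *)
Lemma spinor_form_product x y : in_V7 x -> in_V7 y ->
  kf d (g e' *m (g x *m (g y *m d))) = bil B x y * c.
Proof.
move=> [_ xe'] [_ ye'].
have swap u (z : 'cV[F]_16) : bil B u e' = 0 -> g e' *m (g u *m z) = - (g u *m (g e' *m z)).
  by move=> ue; apply: g_anti; rewrite bilC.
have sym : kf d (g x *m (g e' *m (g y *m d))) = kf d (g y *m (g e' *m (g x *m d))).
  by rewrite -spinor_form_adj -spinor_form_adj spinor_formC spinor_form_adj.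
have := congr1 (fun z => kf d (g e' *m z)) (g_swap x y d).
rewrite mulmxBr -scalemxAr spinor_formDr spinor_formNr spinor_formZr.
rewrite (swap x (g y *m d)) // (swap y (g x *m d)) // !spinor_formNr sym => E.
apply: (mulfI (_ : 2%:R != 0)); first by rewrite pnatr_eq0.
by rewrite mulr_natl mulr2n {1}E; ring.
Qed.

Lemma rank_g_isotropic : \rank (g e) = 8%N.
Proof.
have ab : g e *m g e' + g e' *m g e = 1%:M.
  by rewrite (clifford_anticommutator symB gD gE) ee' divff ?pnatr_eq0.
have := @rank_stable_double F 16 16 1%:M (g e) (g e').
rewrite !gE ee e'e' raddf0 => /(_ erefl erefl ab).
rewrite !submx1 mxrank1 mul1mx => /(_ isT isT).
by move=> /(congr1 (divn^~ 2)); rewrite mulnK.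
Qed.

Variable N : 'M[F]_(7, 9).
Hypotheses (NN : N *m B *m N^T = 1%:M) (N7 : forall a : 'rV_7, in_V7 (a *m N)).

Lemma frame7_bil a b : bil B (a *m N) (b *m N) = (a *m b^T) 0 0.
Proof.
rewrite /bil trmx_mul; congr (fun_of_matrix _ 0 0).
by rewrite -!mulmxA (mulmxA B) (mulmxA N) (mulmxA N) NN mul1mx.
Qed.

Lemma frame7_annihilated a : g e *m (g (a *m N) *m d) = 0.
Proof. by rewrite g_anti ?ed ?mulmx0 ?oppr0 // bilC //; case: (N7 a). Qed.

Hypothesis not_pure : ~ exists E : 'M[F]_(4, 9),
  [/\ row_free E, E *m B *m E^T = 0 & forall v : 'rV_9, g v *m d = 0 <-> (v <= E)%MS].

(* Otherwise [V_7 d] is isotropic in [ker e = im e], so its dimension is at most 4 and the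
   annihilator of [d] has dimension 4. *)
Lemma spinor_norm_neq0 : c != 0.
Proof.
apply/negP => /eqP c0; apply: not_pure.
pose Phi := N *m spinor_orbit_mx d.
have PhiE a : a *m Phi = (g (a *m N) *m d)^T by rewrite mulmxA spinor_orbit_mxE.
clearbody Phi.
have ePhi : g e *m Phi^T = 0.
  apply: trmx_inj; rewrite trmx_mul trmxK trmx0; apply/row_matrixP => i.
  by rewrite row0 rowE mulmxA PhiE -trmx_mul frame7_annihilated trmx0.
(* The rows of [X] span [im (g e)] and [e' V_7 d]. Both are orthogonal to [V_7 d], the second
   because [c = 0], and [g e] recovers [V_7 d] from [e' V_7 d]. Hence [8 + 2 * \rank Phi <= 16]. *)
pose X := col_mx (g e)^T (Phi *m (g e')^T).
have XK : X *m (K *m Phi^T) = 0.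
  rewrite mul_col_mx mulmxA adjK -mulmxA ePhi mulmx0.
  suff -> : Phi *m (g e')^T *m (K *m Phi^T) = 0 by rewrite col_mx0.
  apply/matrixP => i j; rewrite mulmxA mulmx_bil !rowE mulmxA !PhiE -trmx_mul [RHS]mxE.
  rewrite -/(kf _ _) 2!spinor_form_adj.
  have [_ xe'] := N7 (delta_mx 0 i).
  rewrite g_anti // spinor_formNr spinor_form_product // c0 mulr0 oppr0 //.
have anti1 : g e *m g e' + g e' *m g e = 1%:M.
  by rewrite (clifford_anticommutator symB gD gE) ee' divff ?pnatr_eq0.
have tPhi : Phi *m (g e')^T *m (g e)^T = Phi.
  apply: trmx_inj; rewrite !trmx_mul !trmxK -[RHS]mul1mx -anti1 mulmxDl.
  by rewrite -(mulmxA (g e') (g e)) ePhi mulmx0 addr0 mulmxA.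
have rkX : \rank X = (8 + \rank Phi)%N.
  rewrite -addsmxE mxrank_disjoint_sum ?mxrank_tr ?rank_g_isotropic.
    congr (_ + _)%N; apply/eqP.
    by rewrite eqn_leq mxrankM_maxl /= -{1}tPhi mxrankM_maxl.
  apply/row_matrixP => i; rewrite row0.
  have := row_sub i ((g e)^T :&: Phi *m (g e')^T)%MS; rewrite sub_capmx.
  case/andP => /submxP[z zE] /submxP[y yE].
  have yP : y *m Phi = 0.
    by rewrite -tPhi mulmxA -yE zE -mulmxA -trmx_mul gE ee raddf0 trmx0 mulmx0.
  by rewrite yE mulmxA yP mul0mx.
have rkPhi : (\rank Phi <= 4)%N.
  have := mulmx0_rank_max XK; rewrite eqmxMfull ?row_full_unit // mxrank_tr rkX.
  rewrite -addnA -[X in (_ <= X)%N]/(8 + 8)%N leq_add2l addnn.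
  by rewrite -[8%N]/(4.*2) leq_double.
pose E9 := kermx (spinor_orbit_mx d).
have E9P v : g v *m d = 0 <-> (v <= E9)%MS.
  split=> [vd|/sub_kermxP]; first by apply/sub_kermxP; rewrite spinor_orbit_mxE vd trmx0.
  by rewrite spinor_orbit_mxE => /(congr1 trmx); rewrite trmxK trmx0.
clearbody E9.
have E9iso : E9 *m B *m E9^T = 0.
  apply/matrixP => i j; rewrite mulmx_bil mxE.
  by apply: annihilator_isotropic; apply/E9P; apply: row_sub.
have le4 : (\rank E9 <= 4)%N.
  have := mulmx0_rank_max (etrans (mulmxA E9 B E9^T) E9iso).
  rewrite eqmxMfull ?row_full_unit // mxrank_tr addnn => le9.
  by rewrite -(doubleK (\rank E9)); apply: half_leq le9.
have freeN : row_free N.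
  by rewrite /row_free eqn_leq rank_leq_row -{1}(mxrank1 F 7) -NN -mulmxA mxrankM_maxl.
have e0 : \rank e = 1%N.
  rewrite rank_rV; case: eqVneq => // e0; move/eqP: ee'.
  by rewrite e0 bil0l eq_sym invr_eq0 pnatr_eq0.
(* At least [7 - 4 = 3] dimensions of [V_7] kill [d], and [e] adds one more. *)
have ge4 : (4 <= \rank E9)%N.
  have sub : (kermx Phi *m N + e <= E9)%MS.
    have eE : (e <= E9)%MS by apply/E9P.
    rewrite addsmx_sub eE andbT; apply/row_subP => i; apply/E9P.
    rewrite row_mul; apply: trmx_inj; rewrite -PhiE trmx0.
    by apply/sub_kermxP; apply: row_sub.
  apply: leq_trans (mxrankS sub); rewrite mxrank_disjoint_sum.
    rewrite e0 mxrankMfree // mxrank_ker addn1 ltnS.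
    by rewrite leq_subRL ?(leq_trans rkPhi) // -[7%N]/(4 + 3)%N addnC leq_add2l.
  apply/row_matrixP => i; rewrite row0.
  have := row_sub i (kermx Phi *m N :&: e)%MS; rewrite sub_capmx.
  case/andP => /submxP[z zE] /sub_rVP[s sE]; rewrite sE.
  have [_ h] := N7 (z *m kermx Phi).
  move: h; rewrite -mulmxA -zE sE bilZl ee' => /eqP.
  by rewrite mulf_eq0 invr_eq0 pnatr_eq0 orbF => /eqP->; rewrite scale0r.
have rk4 : \rank E9 = 4%N by apply/eqP; rewrite eqn_leq le4 ge4.
have [E freeE eqE] := row_base_of_rank rk4.
exists E; split=> // [|v]; last by rewrite eqE; apply: E9P.
have /submxP[D ->] : (E <= E9)%MS by rewrite eqE.
by rewrite trmx_mul -!mulmxA (mulmxA B) 2!(mulmxA E9) E9iso mul0mx mulmx0.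
Qed.

(** The functional [z |-> kf d (g e' z)] isolates [s * c]; composing it with multiplication by each
    basis vector of [V_7] then reads off the coordinates of [a], again up to [c]. *)
Lemma frame7_inj s a : s *: d + g (a *m N) *m d = 0 -> s = 0 /\ a = 0.
Proof.
move=> E; have c0 := spinor_norm_neq0.
have kf0 x : kf d (g e' *m (g x *m d)) = 0 by apply: spinor_form_isotropic.
have s0 : s = 0.
  have := congr1 (fun z => kf d (g e' *m z)) E.
  rewrite mulmxDr mulmx0 -scalemxAr spinor_formDr spinor_formZr kf0 addr0 spinor_form0r.
  by move/eqP; rewrite mulf_eq0 (negPf c0) orbF => /eqP.
split=> //; move: E; rewrite s0 scale0r add0r => E.
apply/rowP => i; have := spinor_form_product (N7 (delta_mx 0 i)) (N7 a).
rewrite E !mulmx0 spinor_form0r bilC // frame7_bil.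
move/esym/eqP; rewrite mulf_eq0 (negPf c0) orbF trmx_delta -colE !mxE.
by move/eqP.
Qed.

(** Dimension count: [ker (g e)] has dimension 8, and [d] together with [V_7 d] already spans
    [1 + 7] dimensions inside it. *)
Lemma annihilated_in_frame7 (z : 'cV[F]_16) :
  g e *m z = 0 -> exists s, exists a, z = s *: d + g (a *m N) *m d.
Proof.
move=> ez; pose Theta := col_mx d^T (N *m spinor_orbit_mx d).
have ThetaE (s : 'M_1) a : row_mx s a *m Theta = (s 0 0 *: d + g (a *m N) *m d)^T.
  rewrite mul_row_col {1}[s]mx11_scalar mul_scalar_mx mulmxA spinor_orbit_mxE.
  by rewrite linearD linearZ.
have free : row_free Theta.
  rewrite -kermx_eq0; apply/eqP/row_matrixP => i; rewrite row0.
  have /sub_kermxP := row_sub i (kermx Theta).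
  move: (row i _) => y; rewrite -[y]hsubmxK ThetaE => /(congr1 trmx).
  rewrite trmxK trmx0 => /frame7_inj[y0 ->].
  by rewrite [lsubmx y]mx11_scalar y0 raddf0 row_mx0.
have sub : (Theta <= kermx (g e)^T)%MS.
  apply/row_subP => i; apply/sub_kermxP; rewrite rowE -[delta_mx 0 i]hsubmxK ThetaE.
  by rewrite -trmx_mul mulmxDr -scalemxAr ed frame7_annihilated scaler0 addr0 trmx0.
have : (kermx (g e)^T <= Theta)%MS.
  rewrite -(geq_leqif (mxrank_leqif_sup sub)) mxrank_ker mxrank_tr rank_g_isotropic.
  by rewrite (eqP free).
move=> sup; have /submxP[D zD] : (z^T <= Theta)%MS.
  by apply: submx_trans sup; apply/sub_kermxP; rewrite -trmx_mul ez trmx0.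
exists (lsubmx D 0 0), (rsubmx D).
by apply: trmx_inj; rewrite -ThetaE hsubmxK.
Qed.

(** The spinor [x y d] is killed by [e] and has no component along [d] because [x] and [y] are
    orthogonal, so it lies in [V_7 d]. Since [x y] squares to -1, the factor ['i] is what makes [z]
    a unit vector. *)
Lemma exists_cross_product x y : in_V7 x -> in_V7 y ->
    bil B x x = 1 -> bil B y y = 1 -> bil B x y = 0 ->
  exists z, [/\ in_V7 z, g x *m (g y *m d) = 'i *: (g z *m d),
    bil B z z = 1, bil B z x = 0 & bil B z y = 0].
Proof.
move=> x7 y7 xx yy xy; have c0 := spinor_norm_neq0.
have [[xe xe'] [ye ye']] := (x7, y7).
have i0 : 'i != 0 :> F by exact: neq0Ci.
have ii : 'i * 'i = -1 :> F by rewrite -expr2 sqrCi.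
have [|s [a sa]] := @annihilated_in_frame7 (g x *m (g y *m d)).
  by rewrite g_anti ?(bilC e) // (g_anti (u := e)) ?(bilC e) // ed !mulmx0 !oppr0 ?mulmx0 oppr0.
have s0 : s = 0.
  have := spinor_form_product x7 y7; rewrite xy mul0r sa mulmxDr -scalemxAr.
  rewrite spinor_formDr spinor_formZr.
  by rewrite spinor_form_isotropic addr0 => /eqP; rewrite mulf_eq0 (negPf c0) orbF => /eqP.
pose z := - 'i *: (a *m N).
have z7 : in_V7 z by rewrite /z scalemxAl; apply: N7.
have xyz : g x *m (g y *m d) = 'i *: (g z *m d).
  by rewrite sa s0 scale0r add0r /z gZ -scalemxAl scalerA mulrN ii opprK scale1r.
clearbody z; have [ze ze'] := z7.
have anti_e' u (w : 'cV[F]_16) : bil B u e' = 0 -> g u *m (g e' *m w) = - (g e' *m (g u *m w)).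
  exact: g_anti.
have bil_z u v : in_V7 u -> g u *m (g x *m (g y *m d)) = g v *m d -> bil B z u = 0.
  move=> u7 uxy.
  have : 'i * kf d (g e' *m (g u *m (g z *m d))) = 0.
    by rewrite -spinor_formZr 2!scalemxAr -xyz uxy spinor_form_isotropic.
  rewrite spinor_form_product // bilC // => /eqP.
  by rewrite mulf_eq0 (negPf i0) /= mulf_eq0 (negPf c0) orbF => /eqP.
have zz : bil B z z = 1.
  apply: (mulIf c0); rewrite mul1r.
  have : kf (g x *m (g y *m d)) (g e' *m (g x *m (g y *m d))) = c.
    rewrite !spinor_form_adj anti_e' // g_g xx scale1r mulmxN spinor_formNr.
    by rewrite anti_e' // g_g yy scale1r spinor_formNr opprK.
  rewrite xyz -!scalemxAr spinor_formZr spinor_formC spinor_formZr spinor_formC.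
  rewrite spinor_form_adj anti_e' // mulrA ii mulN1r spinor_formNr opprK.
  by rewrite spinor_form_product.
exists z; split=> //.
- by apply: (bil_z x y) => //; rewrite g_g xx scale1r.
- apply: (bil_z y (- x)) => //.
  by rewrite g_anti ?(bilC y) // g_g yy scale1r gN mulNmx.
Qed.

(* [(a, b, k)] stands for [n a * n b = n k] in the imaginary octonions; each unordered pair
   occurs once. *)
Definition octonion_lines : seq (nat * nat * nat) :=
  [:: (0, 1, 2); (0, 3, 4); (1, 3, 5); (2, 3, 6); (0, 6, 5); (1, 4, 6); (2, 5, 4);
      (1, 2, 0); (3, 4, 0); (3, 5, 1); (3, 6, 2); (6, 5, 0); (4, 6, 1); (5, 4, 2);
      (2, 0, 1); (4, 0, 3); (5, 1, 3); (6, 2, 3); (5, 0, 6); (6, 1, 4); (4, 2, 5)]%N.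

Definition octonion_table (n : nat -> 'rV[F]_9) :=
  forall a b k, (a, b, k) \in octonion_lines ->
  g (n a) *m (g (n b) *m d) = 'i *: (g (n k) *m d).

Hypothesis N_span : forall x, in_V7 x -> exists a : 'rV_7, x = a *m N.

(** Supplies the doubling unit: a unit vector orthogonal to a quaternionic triple. *)
Lemma exists_unit_orthogonal (a : nat -> 'rV[F]_7) :
  (forall r s, (r < 3)%N -> (s < 3)%N -> bil B (a r *m N) (a s *m N) = (r == s)%:R) ->
  exists l, [/\ in_V7 l, bil B l l = 1 & forall r, (r < 3)%N -> bil B (a r *m N) l = 0].
Proof.
move=> aa; pose C : 'M[F]_(3, 3 + 4) := \matrix_(r < 3) a r.
have CE (D D' : 'rV[F]_7) : bil 1%:M D D' = bil B (D *m N) (D' *m N).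
  by rewrite frame7_bil /bil mulmx1.
have CC : C *m 1%:M *m C^T = 1%:M.
  by apply/matrixP => r s; rewrite mulmx_bil !rowK CE aa // mxE.
have [|||D [DC _ DD]] := @orthonormal_complement F 3 4 C 1%:M.
- by rewrite tr_scalar_mx.
- exact: unitmx1.
- by rewrite CC unitmx1.
exists (row 0 D *m N); split=> [||r r3]; first exact: N7.
  by rewrite -CE -mulmx_bil DD mxE.
have := mulmx_bil 1%:M D C 0 (Ordinal r3).
by rewrite DC mxE rowK CE bilC // => <-.
Qed.

(** The component of [x y d] along [d], detected by pairing with [e' d], is [bil B x y], and
    [g z *m d] has none. *)
Lemma product_orthogonal x y z : in_V7 x -> in_V7 y -> g x *m (g y *m d) = 'i *: (g z *m d) ->
  bil B x y = 0.
Proof.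
move=> x7 y7 xyz; have := spinor_form_product x7 y7.
rewrite xyz -scalemxAr spinor_formZr spinor_form_isotropic mulr0 => /esym/eqP.
by rewrite mulf_eq0 (negPf spinor_norm_neq0) orbF => /eqP.
Qed.

Let ii : 'i * 'i = -1 :> F. Proof. by rewrite -expr2 sqrCi. Qed.

Lemma product_third x y z : g x *m (g y *m d) = 'i *: (g z *m d) ->
  g z *m d = - 'i *: (g x *m (g y *m d)).
Proof. by move=> ->; rewrite scalerA mulNr ii opprK scale1r. Qed.

Lemma product_cycle x y z : in_V7 x -> in_V7 y -> bil B y y = 1 ->
  g x *m (g y *m d) = 'i *: (g z *m d) -> g y *m (g z *m d) = 'i *: (g x *m d).
Proof.
move=> x7 y7 yy xyz; have xy := product_orthogonal x7 y7 xyz.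
have yx : bil B y x = 0 by rewrite bilC.
rewrite (product_third xyz) -scalemxAr (g_anti _ yx) g_g yy scale1r.
by rewrite scalerN scaleNr opprK.
Qed.

(* If [z = y x], [m = y l] and [m' = z l], then [x m = m']: octonionic non-associativity. *)
Lemma product_triple x y z l m m' : bil B x l = 0 -> bil B y l = 0 -> bil B z l = 0 ->
  bil B x y = 0 ->
  g y *m (g x *m d) = 'i *: (g z *m d) -> g y *m (g l *m d) = 'i *: (g m *m d) ->
  g z *m (g l *m d) = 'i *: (g m' *m d) -> g x *m (g m *m d) = 'i *: (g m' *m d).
Proof.
move=> xl yl zl xy yxz ylm zlm.
rewrite (product_third ylm) -zlm -scalemxAr (g_anti (v := l)) // mulmxN.
rewrite (g_anti _ xl) opprK (g_anti _ xy) yxz -scalerN -!scalemxAr scalerA.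
by rewrite mulNr ii opprK scale1r mulmxN (g_anti _ zl) (g_anti (u := l)) ?(bilC l) // opprK.
Qed.

(** Cayley-Dickson doubling. Four of the seven lines hold by construction, [product_triple] gives
    the other three, and [product_cycle] rotates each. Any two units lie on a common line, so
    [product_orthogonal] makes the whole frame orthonormal. *)
Lemma exists_octonion_frame : exists n : nat -> 'rV[F]_9,
  [/\ forall a, (a < 7)%N -> in_V7 (n a),
      forall a b, (a < 7)%N -> (b < 7)%N -> bil B (n a) (n b) = (a == b)%:R
    & octonion_table n].
Proof.
pose dl r : 'rV[F]_7 := delta_mx 0 (inord r).
have dlE r s : (r < 7)%N -> (s < 7)%N -> bil B (dl r *m N) (dl s *m N) = (r == s)%:R.
  move=> r7 s7; rewrite frame7_bil /dl trmx_delta mul_delta_mx_cond mulmxnE mxE eqxx.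
  by rewrite -val_eqE /= !inordK.
pose x := dl 0%N *m N; pose y := dl 1%N *m N.
have [x7 y7] : in_V7 x /\ in_V7 y by split; apply: N7.
have [xx yy xy] : [/\ bil B x x = 1, bil B y y = 1 & bil B x y = 0] by rewrite !dlE.
have [z [z7 xyz zz zx zy]] := exists_cross_product x7 y7 xx yy xy.
have [az zE] := N_span z7.
have [|l [l7 ll la]] := @exists_unit_orthogonal (nth 0 [:: dl 0%N; dl 1%N; az]).
  move=> [|[|[|//]]] [|[|[|//]]] _ _ /=; rewrite -?zE -?/x -?/y //;
    by rewrite ?(bilC x) ?(bilC y) // ?zy ?zx // bilC.
have [xl yl] : bil B x l = 0 /\ bil B y l = 0 by split; [exact: (la 0%N) | exact: (la 1%N)].
have zl : bil B z l = 0 by rewrite zE; apply: (la 2%N).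
have [m1 [m17 xlm1 m11 _ _]] := exists_cross_product x7 l7 xx ll xl.
have [m2 [m27 ylm2 m22 _ _]] := exists_cross_product y7 l7 yy ll yl.
have [m3 [m37 zlm3 m33 _ _]] := exists_cross_product z7 l7 zz ll zl.
clearbody x y; pose n := nth 0 [:: x; y; z; l; m1; m2; m3].
have yzx := product_cycle x7 y7 yy xyz; have zxy := product_cycle y7 z7 zz yzx.
have xm3 := product_triple xl zl yl (etrans (bilC x z symB) zx) zxy zlm3 ylm2.
have ym1 := product_triple yl xl zl (etrans (bilC y x symB) xy) xyz xlm1 zlm3.
have zm2 := product_triple zl yl xl zy yzx ylm2 xlm1.
have n7 a : (a < 7)%N -> in_V7 (n a).
  by move: a => [|[|[|[|[|[|[|//]]]]]]].
have nn a : (a < 7)%N -> bil B (n a) (n a) = 1.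
  by move: a => [|[|[|[|[|[|[|//]]]]]]].
have tab : octonion_table n.
  pose t a b k := g (n a) *m (g (n b) *m d) = 'i *: (g (n k) *m d).
  have cyc a b k : [&& a < 7, b < 7 & k < 7]%N -> t a b k -> [/\ t a b k, t b k a & t k a b].
    case/and3P => a7 b7 k7 abk.
    have bka := product_cycle (n7 _ a7) (n7 _ b7) (nn _ b7) abk.
    by split=> //; apply: product_cycle bka; rewrite ?nn //; apply: n7.
  have [t1 t1' t1''] := cyc 0%N 1%N 2%N isT xyz.
  have [t2 t2' t2''] := cyc 0%N 3%N 4%N isT xlm1.
  have [t3 t3' t3''] := cyc 1%N 3%N 5%N isT ylm2.
  have [t4 t4' t4''] := cyc 2%N 3%N 6%N isT zlm3.
  have [t5 t5' t5''] := cyc 0%N 6%N 5%N isT xm3.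
  have [t6 t6' t6''] := cyc 1%N 4%N 6%N isT ym1.
  have [t7 t7' t7''] := cyc 2%N 5%N 4%N isT zm2.
  clearbody n; move=> a b k; rewrite !inE !xpair_eqE -/(t a b k).
  by do 20?case/orP; (case/andP => /andP[/eqP-> /eqP->] /eqP->).
exists n; split=> // a b a7 b7; have [<-|ab] := eqVneq a b; first exact: nn.
have : has (fun t => (t.1 == (a, b)) || (t.1 == (b, a))) octonion_lines.
  by move: a b a7 b7 ab => [|[|[|[|[|[|[|//]]]]]]] [|[|[|[|[|[|[|//]]]]]]].
case/hasP => [[p k]] pk /orP[]/eqP /= pE; rewrite {}pE in pk.
  exact: product_orthogonal (n7 _ a7) (n7 _ b7) (tab _ _ _ pk).
by rewrite bilC //; apply: product_orthogonal (n7 _ b7) (n7 _ a7) (tab _ _ _ pk).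
Qed.

Lemma octonion_frame_product (n : nat -> 'rV[F]_9) (x y : 'rV[F]_7) :
  (forall a, (a < 7)%N -> in_V7 (n a)) -> (forall a, (a < 7)%N -> bil B (n a) (n a) = 1) ->
  octonion_table n ->
  let M := (\matrix_(a < 7) n a) : 'M[F]_(7, 9) in
  g (x *m M) *m (g (y *m M) *m d) =
    (x *m y^T) 0 0 *: d + 'i *: (g (octonion_cross x y *m M) *m d).
Proof.
move=> n7 nn tab M.
have gM (u : 'rV[F]_7) (z : 'cV[F]_16) : g (u *m M) *m z =
    \sum_a u 0 a *: (g (n a) *m z).
  rewrite mulmx_sum_row (clifford_map_sum gD gZ) mulmx_suml; apply: eq_bigr => a _.
  by rewrite gZ -scalemxAl rowK.
have pos a b k : (a, b, k) \in octonion_lines ->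
  g (n a) *m (g (n b) *m d) = 'i *: (g (n k) *m d) by exact: tab.
have lt7 a b k : (a, b, k) \in octonion_lines -> (a < 7)%N && (b < 7)%N.
  have /allP all7 :
    all (fun t : nat * nat * nat => (t.1.1 < 7)%N && (t.1.2 < 7)%N) octonion_lines by [].
  exact: all7.
have neg a b k : (a, b, k) \in octonion_lines ->
    g (n b) *m (g (n a) *m d) = - ('i *: (g (n k) *m d)).
  move=> abk; have /andP[a7 b7] := lt7 _ _ _ abk.
  have ab := product_orthogonal (n7 _ a7) (n7 _ b7) (tab _ _ _ abk).
  have ba : bil B (n b) (n a) = 0 by rewrite bilC.
  by rewrite (g_anti _ ba) (pos _ _ _ abk).
have diag a : (a < 7)%N -> g (n a) *m (g (n a) *m d) = d.
  by move=> a7; rewrite g_g nn // scale1r.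
rewrite 3!gM !sum7 !o7E // !mulmxDr -!scalemxAr !diag //.
rewrite (pos 0%N 1%N 2%N isT) (neg 0%N 1%N 2%N isT) (pos 0%N 3%N 4%N isT) (neg 0%N 3%N 4%N isT)
   (pos 1%N 3%N 5%N isT) (neg 1%N 3%N 5%N isT) (pos 2%N 3%N 6%N isT) (neg 2%N 3%N 6%N isT)
   (pos 0%N 6%N 5%N isT) (neg 0%N 6%N 5%N isT) (pos 1%N 4%N 6%N isT) (neg 1%N 4%N 6%N isT)
   (pos 2%N 5%N 4%N isT) (neg 2%N 5%N 4%N isT) (pos 1%N 2%N 0%N isT) (neg 1%N 2%N 0%N isT)
   (pos 3%N 4%N 0%N isT) (neg 3%N 4%N 0%N isT) (pos 3%N 5%N 1%N isT) (neg 3%N 5%N 1%N isT)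
   (pos 3%N 6%N 2%N isT) (neg 3%N 6%N 2%N isT) (pos 6%N 5%N 0%N isT) (neg 6%N 5%N 0%N isT)
   (pos 4%N 6%N 1%N isT) (neg 4%N 6%N 1%N isT) (pos 5%N 4%N 2%N isT) (neg 5%N 4%N 2%N isT)
   (pos 2%N 0%N 1%N isT) (neg 2%N 0%N 1%N isT) (pos 4%N 0%N 3%N isT) (neg 4%N 0%N 3%N isT)
   (pos 5%N 1%N 3%N isT) (neg 5%N 1%N 3%N isT) (pos 6%N 2%N 3%N isT) (neg 6%N 2%N 3%N isT)
   (pos 5%N 0%N 6%N isT) (neg 5%N 0%N 6%N isT) (pos 6%N 1%N 4%N isT) (neg 6%N 1%N 4%N isT)
   (pos 4%N 2%N 5%N isT) (neg 4%N 2%N 5%N isT).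
move: (g (n 0%N) *m d) (g (n 1%N) *m d) (g (n 2%N) *m d) (g (n 3%N) *m d) (g (n 4%N) *m d)
  (g (n 5%N) *m d) (g (n 6%N) *m d) => q0 q1 q2 q3 q4 q5 q6.
rewrite /octonion_cross !row7E //= mxE sum7 ![_^T _ _]mxE.
by apply/matrixP => r s; rewrite !mxE; ring.
Qed.

End Frame.

(** * Weight frames and the planes of the zero locus *)

Section WeightFrame.
Variables (F : numClosedFieldType) (B : 'M[F]_9).
Hypotheses (symB : B^T = B) (uB : B \in unitmx).
Variable g : 'rV[F]_9 -> 'M[F]_16.
Hypotheses (gD : forall u v, g (u + v) = g u + g v) (gZ : forall c u, g (c *: u) = c *: g u).
Hypothesis gE : forall v, g v *m g v = (bil B v v)%:M.
Variable d : 'cV[F]_16.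
Hypothesis (d0 : d != 0).

(** The interface between spinor and [G_2]: a hyperbolic pair, and a copy [b] of the weight basis in
    its orthogonal complement. Non-purity of [d] survives as [wf_inj]. *)
Record weight_frame (e e' : 'rV[F]_9) (b : 'M[F]_(7, 9)) : Prop := WeightFrame {
  wf_ed : g e *m d = 0;
  wf_ee : bil B e e = 0;
  wf_e'e' : bil B e' e' = 0;
  wf_ee' : bil B e e' = 2%:R^-1;
  wf_bb : forall x y : 'rV_7, bil B (x *m b) (y *m b) = 2%:R * (x *m form7 F *m y^T) 0 0;
  wf_be : forall x : 'rV_7, bil B (x *m b) e = 0;
  wf_be' : forall x : 'rV_7, bil B (x *m b) e' = 0;
  wf_span : forall w, exists x : 'rV_7, exists s, exists t, w = x *m b + s *: e + t *: e';
  wf_inj : forall x : 'rV_7, g (x *m b) *m d = 0 -> x = 0;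
  wf_product : forall x y : 'rV_7, g (x *m b) *m (g (y *m b) *m d) =
    (2%:R * (x *m form7 F *m y^T) 0 0) *: d +
    (2%:R * 'i) *: (g (cross7 (wedge x y) *m b) *m d) }.

Lemma exists_weight_frame (K : 'M[F]_16) : K^T = K -> K != 0 ->
  (forall u v, bil B u u = 1 -> bil B v v = 1 -> (g u *m g v)^T *m K *m (g u *m g v) = K) ->
  bil K d^T d^T = 0 ->
  ~ (exists E : 'M[F]_(4, 9),
    [/\ row_free E, E *m B *m E^T = 0 & forall v : 'rV_9, g v *m d = 0 <-> (v <= E)%MS]) ->
  exists e e' b, weight_frame e e' b.
Proof.
move=> symK K0 spinK dQ not_pure.
have adjK := invariant_form_adjoint symB uB gD gZ gE spinK.
have uK := invariant_form_unit symB uB gD gZ gE K0 spinK.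
have [e e0 ed] := exists_annihilator symB gD gZ gE symK uK adjK dQ.
have ee := annihilator_isotropic symB gD gE d0 ed ed.
have [e' e'e' ee'] := exists_dual_isotropic symB uB e0 ee.
have [N [NN N7 N_span]] := exists_frame7 symB uB ee e'e' ee'.
have [n [n7 nn tab]] :=
  exists_octonion_frame symB uB gD gZ gE symK uK adjK d0 dQ ed ee e'e' ee' NN N7 not_pure N_span.
pose M : 'M[F]_(7, 9) := \matrix_(a < 7) n a.
have MM : M *m B *m M^T = 1%:M.
  by apply/matrixP => i j; rewrite mulmx_bil !rowK nn // mxE.
have M7 (a : 'rV_7) : in_V7 B e e' (a *m M).
  rewrite mulmx_sum_row; split; rewrite /bil !mulmx_suml summxE big1 // => i _;
    rewrite -!scalemxAl mxE rowK -/(bil B _ _); have [h h'] := n7 i (ltn_ord i);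
    by rewrite ?h ?h' mulr0.
have M_span x : in_V7 B e e' x -> exists a : 'rV_7, x = a *m M.
  (* [A] is the transition matrix between two orthonormal frames of [V_7], hence orthogonal and
     invertible. *)
  move=> x7; pose A := M *m B *m N^T.
  have coord (y : 'rV_9) : in_V7 B e e' y -> y = y *m B *m N^T *m N.
    by case/N_span => a ->; rewrite -!mulmxA (mulmxA B) 2!(mulmxA N) NN mul1mx.
  have MA : M = A *m N.
    by apply/row_matrixP => i; rewrite rowK !row_mul rowK; apply: coord; apply: n7.
  clearbody A; have AA : A *m A^T = 1%:M.
    by rewrite -MM MA trmx_mul -!mulmxA (mulmxA B) 2!(mulmxA N) NN mul1mx.
  have [uA _] := mulmx1_unit AA.
  exists (x *m B *m N^T *m invmx A); rewrite MA mulmxA mulmxKV //; exact: coord.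
exists e, e', (octonion_basis F *m M).
have bM (x : 'rV[F]_7) : x *m (octonion_basis F *m M) = x *m octonion_basis F *m M.
  by rewrite mulmxA.
split=> //.
- by move=> x y; rewrite !bM (frame7_bil MM) octonion_basis_dot.
- by move=> x; rewrite bM; case: (M7 (x *m octonion_basis F)).
- by move=> x; rewrite bM; case: (M7 (x *m octonion_basis F)).
- move=> w; pose s := 2%:R * bil B w e'; pose t := 2%:R * bil B w e.
  have [|x xE] := M_span (w - s *: e - t *: e').
    by split; rewrite !(bilDl, bilNl, bilZl) ?ee ?e'e' ?(bilC e' e symB) ?ee' /s /t; field.
  exists (x *m invmx (octonion_basis F)), s, t.
  by rewrite bM mulmxKV ?octonion_basis_unit // -xE addrAC !subrK.
- move=> x xd; have [|_ x0] := @frame7_inj _ _ symB uB _ gD gZ gE _ symK uK adjK _ d0 dQ _ _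
      ed ee e'e' ee' _ MM M7 not_pure 0 (x *m octonion_basis F).
    by rewrite scale0r add0r -bM.
  by apply: (can_inj (mulmxK (octonion_basis_unit F))); rewrite x0 mul0mx.
- move=> x y; rewrite !bM.
  have nn1 a : (a < 7)%N -> bil B (n a) (n a) = 1 by move=> a7; rewrite nn // eqxx.
  rewrite (octonion_frame_product symB uB gD gZ gE symK uK adjK d0 dQ ed ee e'e' ee' MM M7
             not_pure _ _ n7 nn1 tab).
  rewrite octonion_basis_dot octonion_basis_cross -scalemxAl gZ -scalemxAl scalerA.
  by congr (_ + _ *: _); rewrite mulrC.
Qed.

Let g_swap u v (z : 'cV[F]_16) := clifford_swap symB gD gE u v z.
Let g_g u (z : 'cV[F]_16) := clifford_square gE u z.

(* [im (U (x) Delta -> Delta)] is the kernel of the product of a basis of [U]. *)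
Lemma mem_clifford_image (U : 'M[F]_(2, 9)) : row_free U -> U *m B *m U^T = 0 ->
  (exists a : 'I_2 -> 'cV[F]_16, d = \sum_i g (row i U) *m a i) <->
  g (row 0 U) *m (g (row 1 U) *m d) = 0.
Proof.
move=> freeU isoU; set u0 := row 0 U; set u1 := row 1 U.
have bilU i j : bil B (row i U) (row j U) = 0 by rewrite -mulmx_bil isoU mxE.
have uu u v (z : 'cV[F]_16) : bil B u v = 0 -> g u *m (g v *m z) = - (g v *m (g u *m z)).
  by move=> uv; rewrite g_swap uv mulr0 scale0r sub0r.
have sqU i (z : 'cV[F]_16) : g (row i U) *m (g (row i U) *m z) = 0.
  by rewrite g_g bilU scale0r.
split=> [[a ->]|u01].
  rewrite !big_ord_recr big_ord0 /= add0r -/u0.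
  have -> : widen_ord (leqnSn 1) ord_max = 0 :> 'I_2 by apply/val_inj.
  have -> : ord_max = 1 :> 'I_2 by apply/val_inj.
  by rewrite !mulmxDr sqU mulmx0 addr0 (uu u1) ?bilU // mulmxN sqU oppr0.
have freeUB : row_free (U *m B) by rewrite /row_free mxrankMfree // row_free_unit.
(* Half of a dual family, so that [u_i w_i + w_i u_i = 1] and [w_i] contracts [u_i]. Thus
   [d = u1 w1 d + w1 u1 d], and [u0 u1 d = 0] gives [u1 d = u0 w0 u1 d]; it remains to move [u0] in
   front of [w1]. *)
pose W := 2%:R^-1 *: (pinvmx (U *m B))^T.
have WU i j : 2%:R * bil B (row i U) (row j W) = (i == j)%:R.
  rewrite -mulmx_bil linearZ /= trmxK -scalemxAr mulmxVp // !mxE mulrA.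
  by rewrite divff ?pnatr_eq0 // mul1r.
pose w0 := row 0 W; pose w1 := row 1 W.
have d1 : d = g u1 *m (g w1 *m d) + g w1 *m (g u1 *m d).
  by rewrite g_swap WU scale1r subrK.
have d2 : g u1 *m d = g u0 *m (g w0 *m (g u1 *m d)).
  by rewrite g_swap WU scale1r u01 mulmx0 subr0.
have w1u0 : bil B w1 u0 = 0.
  by have /eqP := WU 0 1; rewrite mulf_eq0 pnatr_eq0 /= bilC // => /eqP.
exists (fun i => if i == 0 then - (g w1 *m (g w0 *m (g u1 *m d))) else g w1 *m d).
rewrite !big_ord_recr big_ord0 /= add0r.
have -> : widen_ord (leqnSn 1) ord_max = 0 :> 'I_2 by apply/val_inj.
have -> : ord_max = 1 :> 'I_2 by apply/val_inj.
rewrite /= -/u0 -/u1 mulmxN -(uu w1) // -d2 addrC; exact: d1.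
Qed.

Variables (e e' : 'rV[F]_9) (b : 'M[F]_(7, 9)).
Hypothesis wf : weight_frame e e' b.

Definition frame8 : 'M[F]_(7 + 1, 9) := col_mx b e.
(** The form on [e^perp] is degenerate, with radical spanned by [e]: hence the zero last row and
    column. *)
Definition form8 : 'M[F]_(7 + 1) := block_mx (form7 F) 0 0 0.

Lemma form8_bil (u v : 'rV[F]_(7 + 1)) :
  bil form8 u v = (lsubmx u *m form7 F *m (lsubmx v)^T) 0 0.
Proof.
rewrite /bil -{1}[u]hsubmxK -{1}[v]hsubmxK mul_row_block !mulmx0 addr0 add0r.
by rewrite tr_row_mx mul_row_col mul0mx addr0.
Qed.

Lemma frame8E (u : 'rV[F]_(7 + 1)) : u *m frame8 = lsubmx u *m b + rsubmx u 0 0 *: e.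
Proof.
by rewrite -{1}[u]hsubmxK mul_row_col {1}[rsubmx u]mx11_scalar mul_scalar_mx.
Qed.

Lemma frame8_bil u v : bil B (u *m frame8) (v *m frame8) = 2%:R * bil form8 u v.
Proof.
rewrite !frame8E !(bilDl, bilDr, bilZl, bilZr) (wf_ee wf) (wf_be wf).
by rewrite (bilC e _ symB) (wf_be wf) (wf_bb wf) form8_bil; ring.
Qed.

Lemma frame8_inj (u : 'rV[F]_(7 + 1)) : u *m frame8 = 0 -> u = 0.
Proof.
rewrite frame8E => u0; have := bil0l B e'.
rewrite -u0 bilDl bilZl (wf_be' wf) (wf_ee' wf) add0r => /eqP.
rewrite mulf_eq0 invr_eq0 pnatr_eq0 orbF => /eqP r0.
move: u0; rewrite r0 scale0r addr0 => u0.
have l0 : lsubmx u = 0.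
  apply: (can_inj (mulmxK (form7_unit F))); rewrite mul0mx; apply/rowP => j.
  have E : (lsubmx u *m form7 F *m (delta_mx 0 j : 'rV[F]_7)^T) 0 0 = (lsubmx u *m form7 F) 0 j.
    by rewrite trmx_delta -colE mxE.
  have := wf_bb wf (lsubmx u) (delta_mx 0 j); rewrite u0 bil0l E => /esym/eqP.
  by rewrite mulf_eq0 pnatr_eq0 /= => /eqP->; rewrite mxE.
by rewrite -[u]hsubmxK l0 [rsubmx u]mx11_scalar r0 raddf0 row_mx0.
Qed.

Lemma row_free_frame8 : row_free frame8.
Proof.
rewrite -kermx_eq0; apply/eqP/row_matrixP => i; rewrite row0.
by apply: frame8_inj; apply/sub_kermxP; apply: row_sub.
Qed.

Definition null8 (u v : 'rV[F]_(7 + 1)) := cross7 (wedge (lsubmx u) (lsubmx v)) = 0.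

Lemma frame8_product (u v : 'rV[F]_(7 + 1)) : bil form8 u v = 0 ->
  g (u *m frame8) *m (g (v *m frame8) *m d) = 0 <-> null8 u v.
Proof.
move=> uv; rewrite !frame8E !gD !gZ !mulmxDl -!scalemxAl (wf_ed wf) scaler0 addr0.
have -> : g e *m (g (lsubmx v *m b) *m d) = 0.
  by rewrite g_swap bilC // (wf_be wf) mulr0 scale0r sub0r (wf_ed wf) mulmx0 oppr0.
rewrite scaler0 addr0 (wf_product wf) -form8_bil uv mulr0 scale0r add0r.
split=> [/eqP|->]; last by rewrite !mul0mx (_ : g 0 = 0) ?mul0mx ?scaler0 // (clifford_map0 gZ).
rewrite scaler_eq0 mulf_eq0 pnatr_eq0 (negPf (neq0Ci _)) /= => /eqP.
exact: (wf_inj wf).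
Qed.

(** The point is that [U] lies in [e^perp], that is [t0 = t1 = 0]. Applying [e] to [u0 u1 d = 0]
    shows that [t0 x1 - t1 x0] kills [d], hence vanishes, so [t0 u1 - t1 u0 = r e] lies in [U].
    Isotropy of [U] gives [r t0 = r t1 = 0], and if [r = 0] then independence of [u0], [u1]
    concludes. *)
Lemma annihilated_plane (U : 'M[F]_(2, 9)) :
  [/\ row_free U, U *m B *m U^T = 0 & g (row 0 U) *m (g (row 1 U) *m d) = 0] <->
  exists U8 : 'M[F]_(2, 7 + 1), [/\ U = U8 *m frame8, row_free U8,
    U8 *m form8 *m U8^T = 0 & null8 (row 0 U8) (row 1 U8)].
Proof.
split=> [[freeU isoU Ud]|[U8 [-> free8 iso8 null]]]; last first.
  split; first by rewrite /row_free mxrankMfree ?row_free_frame8.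
    apply/matrixP => i j; rewrite mulmx_bil !row_mul frame8_bil -mulmx_bil iso8.
    by rewrite !mxE mulr0.
  by rewrite !row_mul; apply/frame8_product => //; rewrite -mulmx_bil iso8 mxE.
have bilU i j : bil B (row i U) (row j U) = 0 by rewrite -mulmx_bil isoU mxE.
have [x0 [s0 [t0 u0E]]] := wf_span wf (row 0 U).
have [x1 [s1 [t1 u1E]]] := wf_span wf (row 1 U).
have xe' x (z : 'cV[F]_16) : g (x *m b) *m (g e' *m z) = - (g e' *m (g (x *m b) *m z)).
  by rewrite g_swap (wf_be' wf) mulr0 scale0r sub0r.
have ee'z (z : 'cV[F]_16) : g e *m (g e' *m z) = z - g e' *m (g e *m z).
  by rewrite g_swap (wf_ee' wf) divff ?pnatr_eq0 // scale1r.
have exz x (z : 'cV[F]_16) : g e *m (g (x *m b) *m z) = - (g (x *m b) *m (g e *m z)).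
  by rewrite g_swap bilC // (wf_be wf) mulr0 scale0r sub0r.
have w0 : t0 *: x1 - t1 *: x0 = 0.
  apply: (wf_inj wf); rewrite mulmxDl gD mulmxDl -scalemxAl gZ -scalemxAl.
  rewrite -scaleNr -scalemxAl gZ -scalemxAl scaleNr.
  move/(congr1 (mulmx (g e))): Ud; rewrite u0E u1E !gD !gZ !mulmxDl -!scalemxAl.
  rewrite (wf_ed wf) scaler0 addr0 !mulmxDr -!scalemxAr !ee'z !xe' !mulmxN !ee'z.
  rewrite !exz (wf_ed wf) !(mulmx0, oppr0, subr0) !g_g (wf_e'e' wf) !scale0r.
  rewrite !(scaler0, addr0, add0r, mulmx0) -scalemxAr ee'z exz (wf_ed wf).
  by rewrite !(scaler0, addr0, mulmx0, oppr0, subr0) scalerN addrC.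
pose r := t0 * s1 - t1 * s0.
have rE : t0 *: row 1 U - t1 *: row 0 U = r *: e.
  have x10 : t0 *: (x1 *m b) = t1 *: (x0 *m b).
    by apply/eqP; rewrite -subr_eq0 !scalemxAl -mulmxBl w0 mul0mx.
  rewrite u0E u1E !scalerDr !scalerA x10 /r scalerBl (mulrC t1 t0).
  by rewrite !opprD !addrA; apply/matrixP => i j; rewrite !mxE; ring.
have [rt0 rt1] : r * t0 = 0 /\ r * t1 = 0.
  have ue x s t : bil B (x *m b + s *: e + t *: e') (r *: e) = 2%:R^-1 * (r * t).
    rewrite !(bilDl, bilZl, bilZr) (wf_be wf) (wf_ee wf) (bilC e' e symB) (wf_ee' wf); ring.
  have row_r i : bil B (row i U) (r *: e) = 0.
    by rewrite -rE bilDr bilNr !bilZr !bilU !mulr0 subr0.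
  split; have := row_r 0; have := row_r 1; rewrite u0E u1E !ue => /eqP + /eqP.
    by rewrite !mulf_eq0 !invr_eq0 !pnatr_eq0 /= -!mulf_eq0 => _ /eqP.
  by rewrite !mulf_eq0 !invr_eq0 !pnatr_eq0 /= -!mulf_eq0 => /eqP.
have t00 : t0 = 0 /\ t1 = 0.
  have [r0|r0] := eqVneq r 0; last first.
    by move/eqP: rt0; move/eqP: rt1; rewrite !mulf_eq0 (negPf r0) /= => /eqP-> /eqP->.
  pose c : 'rV[F]_2 := t0 *: delta_mx 0 1 - t1 *: delta_mx 0 0.
  have c0 : c = 0.
    apply: (can_inj (mulmxKp freeU)); rewrite mul0mx /c mulmxBl -!scalemxAl -!rowE.
    by rewrite rE r0 scale0r.
  split; [move/rowP/(_ 1): c0 | move/rowP/(_ 0): c0]; rewrite !mxE /=.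
    by rewrite mulr1 mulr0 subr0.
  by rewrite mulr1 mulr0 add0r => /eqP; rewrite oppr_eq0 => /eqP.
case: t00 => t00 t10; move: u0E u1E; rewrite t00 t10 !scale0r !addr0 => u0E u1E.
pose U8 : 'M[F]_(2, 7 + 1) :=
  \matrix_(i < 2) (if i == 0 then row_mx x0 s0%:M else row_mx x1 s1%:M).
have UE : U = U8 *m frame8.
  apply/row_matrixP => i; rewrite row_mul rowK frame8E.
  case: eqP => [->|/eqP i0]; rewrite row_mxKl row_mxKr [_%:M _ _]mxE eqxx mulr1n //.
  by rewrite -u1E; congr (row _ U); apply/val_inj; case: i i0 => [[|[|]]].
have bil8 i j : bil form8 (row i U8) (row j U8) = 0.
  have := bilU i j; rewrite UE !row_mul frame8_bil => /eqP.
  by rewrite mulf_eq0 pnatr_eq0 => /eqP.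
exists U8; split=> //.
- rewrite /row_free eqn_leq rank_leq_row /=; move: freeU; rewrite /row_free UE => /eqP {1}<-.
  exact: mxrankM_maxl.
- by apply/matrixP => i j; rewrite mulmx_bil bil8 mxE.
- by apply/frame8_product => //; rewrite -!row_mul -UE.
Qed.

End WeightFrame.

(** * The action of G_2 *)

Section G2Action.
Variable F : numClosedFieldType.
Local Notation e i := (g2_e F i).
Local Notation f i := (g2_f F i).

(** Applies to the simple root vectors: under the two simple [SL_2] the space [V_7] splits as
    [2 + 3 + 2] and [2 + 2 + 1 + 1 + 1], so their cubes vanish. *)
Lemma exp_nil_cube0 (x : 'M[F]_7) : x *m x *m x = 0 ->
  exp_nil x = 1%:M + x + 2%:R^-1 *: (x *m x).
Proof.
move=> x3; have x3' n : x ^+ n.+3 = 0.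
  by rewrite !exprS !mulrA -!mulmxE x3 mul0mx.
rewrite /exp_nil !big_ord_recl big_ord0 /= !x3' !scaler0 !addr0.
by rewrite expr0 expr1 expr2 invr1 !scale1r addrA.
Qed.

Lemma elem7_mul a b (v : 'cV[F]_7) i : (b < 7)%N ->
  (elem7 F a b *m v) i 0 = (i == a :> nat)%:R * v (o7 b) 0.
Proof.
move=> b7; rewrite mxE (bigD1 (o7 b)) //= mxE o7E // eqxx andbT big1 ?addr0 // => j jb.
rewrite mxE (_ : (j == b :> nat) = false) ?andbF ?mul0r //.
by apply: contraNF jb => /eqP jb; apply/eqP/val_inj; rewrite /= o7E.
Qed.

Let colD (A B : 'cV[F]_7) i : (A + B) i 0 = A i 0 + B i 0. Proof. by rewrite mxE. Qed.
Let colZ c (A : 'cV[F]_7) i : (c *: A) i 0 = c * A i 0. Proof. by rewrite mxE. Qed.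

Lemma row7_eta (x : 'rV[F]_7) : x = row7 [:: x 0 (o7 0); x 0 (o7 1); x 0 (o7 2);
  x 0 (o7 3); x 0 (o7 4); x 0 (o7 5); x 0 (o7 6)].
Proof. by apply/rowP; elim/ord7P; rewrite row7E. Qed.

Section Rows.
Variables a0 a1 a2 a3 a4 a5 a6 : F.
Local Notation x := (row7 [:: a0; a1; a2; a3; a4; a5; a6]).

Lemma e0_row : x *m (e 0)^T = row7 [:: a1; 0; 2%:R * a3; a4; 0; a6; 0].
Proof.
apply: trmx_inj; rewrite trmx_mul trmxK; apply/colP; elim/ord7P;
rewrite /g2_e /= !mulmxDl -scalemxAl !(colD, colZ) !elem7_mul // !mxE !o7E //=; ring.
Qed.

Lemma e1_row : x *m (e 1)^T = row7 [:: 0; a2; 0; 0; a5; 0; 0].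
Proof.
apply: trmx_inj; rewrite trmx_mul trmxK; apply/colP; elim/ord7P;
rewrite /g2_e /= !mulmxDl !(colD, colZ) !elem7_mul // !mxE !o7E //=; ring.
Qed.

Lemma f0_row : x *m (f 0)^T = row7 [:: 0; a0; 0; a2; 2%:R * a3; 0; a5].
Proof.
apply: trmx_inj; rewrite trmx_mul trmxK; apply/colP; elim/ord7P;
rewrite /g2_f /= !mulmxDl -scalemxAl !(colD, colZ) !elem7_mul // !mxE !o7E //=; ring.
Qed.

Lemma f1_row : x *m (f 1)^T = row7 [:: 0; 0; a1; 0; 0; a4; 0].
Proof.
apply: trmx_inj; rewrite trmx_mul trmxK; apply/colP; elim/ord7P;
rewrite /g2_f /= !mulmxDl !(colD, colZ) !elem7_mul // !mxE !o7E //=; ring.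
Qed.
End Rows.

Lemma mulmx_row_inj (A A' : 'M[F]_7) :
  (forall x : 'rV[F]_7, x *m A = x *m A') -> A = A'.
Proof. by move=> AA; apply/row_matrixP => i; rewrite !rowE. Qed.

Lemma cube0_of_rows (x : 'M[F]_7) : (forall v : 'rV[F]_7, v *m x^T *m x^T *m x^T = 0) ->
  x *m x *m x = 0.
Proof.
move=> x3; apply: trmx_inj; rewrite !trmx_mul trmx0; apply: mulmx_row_inj => v.
by rewrite mulmx0 !mulmxA.
Qed.

Lemma exp_row (t : F) (x : 'M[F]_7) (v : 'rV[F]_7) :
  (forall v : 'rV[F]_7, v *m x^T *m x^T *m x^T = 0) ->
  v *m (exp_nil (t *: x))^T = v + t *: (v *m x^T) + (2%:R^-1 * t ^+ 2) *: (v *m x^T *m x^T).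
Proof.
move=> x3; rewrite exp_nil_cube0.
  rewrite !linearD !linearZ /= trmx_mul linearZ /= trmx1 mulmx1 [(t *: x)^T]linearZ /=
    -?scalemxAr !linearZ /= !scalerA mulmxA.
  by rewrite expr2 mulrA.
by rewrite -!scalemxAl -!scalemxAr -scalemxAl cube0_of_rows // !scaler0.
Qed.

Lemma row7_0 : row7 [:: 0; 0; 0; 0; 0; 0; 0] = 0 :> 'rV[F]_7.
Proof. by apply/rowP; elim/ord7P; rewrite row7E // mxE. Qed.

Section Exponentials.
Variables t a0 a1 a2 a3 a4 a5 a6 : F.
Local Notation x := (row7 [:: a0; a1; a2; a3; a4; a5; a6]).

Lemma exp_e0_row : x *m (exp_nil (t *: e 0))^T =
  row7 [:: a0 + t * a1; a1; a2 + 2%:R * t * a3 + t ^+ 2 * a4; a3 + t * a4; a4; a5 + t * a6; a6].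
Proof.
rewrite exp_row => [|v]; last by rewrite [v]row7_eta !e0_row mulr0 row7_0.
by rewrite !e0_row; apply/rowP; elim/ord7P; rewrite !mxE !o7E //=; field.
Qed.

Lemma exp_e1_row : x *m (exp_nil (t *: e 1))^T =
  row7 [:: a0; a1 + t * a2; a2; a3; a4 + t * a5; a5; a6].
Proof.
rewrite exp_row => [|v]; last by rewrite [v]row7_eta !e1_row row7_0.
by rewrite !e1_row; apply/rowP; elim/ord7P; rewrite !mxE !o7E //=; field.
Qed.

Lemma exp_f0_row : x *m (exp_nil (t *: f 0))^T =
  row7 [:: a0; a1 + t * a0; a2; a3 + t * a2; a4 + 2%:R * t * a3 + t ^+ 2 * a2; a5; a6 + t * a5].
Proof.
rewrite exp_row => [|v]; last by rewrite [v]row7_eta !f0_row mulr0 row7_0.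
by rewrite !f0_row; apply/rowP; elim/ord7P; rewrite !mxE !o7E //=; field.
Qed.

Lemma exp_f1_row : x *m (exp_nil (t *: f 1))^T =
  row7 [:: a0; a1; a2 + t * a1; a3; a4; a5 + t * a4; a6].
Proof.
rewrite exp_row => [|v]; last by rewrite [v]row7_eta !f1_row row7_0.
by rewrite !f1_row; apply/rowP; elim/ord7P; rewrite !mxE !o7E //=; field.
Qed.
End Exponentials.

Lemma ord2P (P : 'I_2 -> Prop) : P 0 -> P 1 -> forall i, P i.
Proof.
move=> P0 P1 [[|[|//]] lt2].
- by have -> : Ordinal lt2 = 0 by apply/val_inj.
- by have -> : Ordinal lt2 = 1 by apply/val_inj.
Qed.

Let form (x y : 'rV[F]_7) := (x *m form7 F *m y^T) 0 0.

Definition preserves_g2 (h : 'M[F]_7) := forall x y : 'rV[F]_7,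
  form (x *m h^T) (y *m h^T) = form x y /\
  cross7 (wedge (x *m h^T) (y *m h^T)) = cross7 (wedge x y) *m h^T.

Lemma preserves_g2_e i t : preserves_g2 (exp_nil (t *: e i)).
Proof.
move=> x y; rewrite [x]row7_eta [y]row7_eta; elim/ord2P: i.
- rewrite /cross7 /= !exp_e0_row; split; first by rewrite /form !form7_bil /= !row7E //=; ring.
  by apply/rowP; elim/ord7P; rewrite !row7E //= !wedgeE !row7E //=; field.
- rewrite /cross7 /= !exp_e1_row; split; first by rewrite /form !form7_bil /= !row7E //=; ring.
  by apply/rowP; elim/ord7P; rewrite !row7E //= !wedgeE !row7E //=; field.
Qed.

Lemma preserves_g2_f i t : preserves_g2 (exp_nil (t *: f i)).
Proof.
move=> x y; rewrite [x]row7_eta [y]row7_eta; elim/ord2P: i.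
- rewrite /cross7 /= !exp_f0_row; split; first by rewrite /form !form7_bil /= !row7E //=; ring.
  by apply/rowP; elim/ord7P; rewrite !row7E //= !wedgeE !row7E //=; field.
- rewrite /cross7 /= !exp_f1_row; split; first by rewrite /form !form7_bil /= !row7E //=; ring.
  by apply/rowP; elim/ord7P; rewrite !row7E //= !wedgeE !row7E //=; field.
Qed.

Lemma preserves_g2_mul (g h : 'M[F]_7) : preserves_g2 g -> preserves_g2 h -> preserves_g2 (g *m h).
Proof.
move=> Pg Ph x y; rewrite trmx_mul !mulmxA.
have [-> ->] := Pg (x *m h^T) (y *m h^T); have [-> ->] := Ph x y.
by [].
Qed.

Lemma g2_group_preserves (g : 'M[F]_7) : g2_group g -> preserves_g2 g.
Proof.
elim=> [x y|i t h _ IH|i t h _ IH]; first by rewrite trmx1 !mulmx1.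
- exact: preserves_g2_mul (preserves_g2_e i t) IH.
- exact: preserves_g2_mul (preserves_g2_f i t) IH.
Qed.

Lemma g2_group_mul (g h : 'M[F]_7) : g2_group g -> g2_group h -> g2_group (g *m h).
Proof.
move=> Gg Gh; elim: Gg => [|i t k _ IH|i t k _ IH]; first by rewrite mul1mx.
- by rewrite -mulmxA; apply: g2_group_e.
- by rewrite -mulmxA; apply: g2_group_f.
Qed.

Lemma g2_group_exp_e i (t : F) : g2_group (exp_nil (t *: e i)).
Proof. by rewrite -[exp_nil _]mulmx1; apply/g2_group_e/g2_group1. Qed.

Lemma g2_group_exp_f i (t : F) : g2_group (exp_nil (t *: f i)).
Proof. by rewrite -[exp_nil _]mulmx1; apply/g2_group_f/g2_group1. Qed.

Lemma exp_e_inv i t : exp_nil (t *: e i) *m exp_nil (- t *: e i) = 1%:M.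
Proof.
apply: trmx_inj; rewrite trmx_mul trmx1; apply: mulmx_row_inj => x; rewrite mulmx1 mulmxA.
rewrite [x]row7_eta; elim/ord2P: i; [rewrite !exp_e0_row | rewrite !exp_e1_row];
  by apply/rowP; elim/ord7P; rewrite !row7E //=; ring.
Qed.

Lemma exp_f_inv i t : exp_nil (t *: f i) *m exp_nil (- t *: f i) = 1%:M.
Proof.
apply: trmx_inj; rewrite trmx_mul trmx1; apply: mulmx_row_inj => x; rewrite mulmx1 mulmxA.
rewrite [x]row7_eta; elim/ord2P: i; [rewrite !exp_f0_row | rewrite !exp_f1_row];
  by apply/rowP; elim/ord7P; rewrite !row7E //=; ring.
Qed.

(** [g2_group] is generated by words without inverses; the inverse is the reversed word with negated
    parameters. *)
Lemma g2_group_inv (g : 'M[F]_7) : g2_group g -> exists2 h, g2_group h & g *m h = 1%:M.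
Proof.
elim=> [|i t k _ [h Gh kh]|i t k _ [h Gh kh]].
- by exists 1%:M; [exact: g2_group1 | rewrite mulmx1].
- exists (h *m exp_nil (- t *: e i)); first exact/g2_group_mul/g2_group_exp_e.
  by rewrite -mulmxA (mulmxA k) kh mul1mx exp_e_inv.
- exists (h *m exp_nil (- t *: f i)); first exact/g2_group_mul/g2_group_exp_f.
  by rewrite -mulmxA (mulmxA k) kh mul1mx exp_f_inv.
Qed.

Lemma g2_group_unit (g : 'M[F]_7) : g2_group g -> g \in unitmx.
Proof. by case/g2_group_inv => h _ /mulmx1_unit[]. Qed.

(** On the standard representation: an upper unipotent makes the first coordinate 1 when [b != 0],
    and a lower one then clears the second. *)
Lemma sl2_clear (a b : F) : exists t, exists s, b + s * (a + t * b) = 0.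
Proof.
have [->|b0] := eqVneq b 0; first by exists 0, 0; ring.
by exists ((1 - a) / b), (- b); field.
Qed.

(** On the 3-dimensional representation, clearing the last coordinate amounts to solving a quadratic
    equation for [s]; [t] is needed only when [a] and [b] both vanish and the equation has no [s] in
    it. *)
Lemma sym2_clear (a b c : F) : exists t, exists s,
  c + 2%:R * s * (b + t * c) + s ^+ 2 * (a + 2%:R * t * b + t ^+ 2 * c) = 0.
Proof.
have [->|a0] := eqVneq a 0.
  have [->|b0] := eqVneq b 0; first by exists 1, (- 1); ring.
  by exists 0, (- c / (2%:R * b)); field; rewrite b0.
exists 0, ((- b + sqrtC (b ^+ 2 - a * c)) / a).
have E := sqrtCK (b ^+ 2 - a * c); set r := sqrtC _ in E *.
transitivity ((r ^+ 2 - (b ^+ 2 - a * c)) / a); first by field.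
by rewrite E subrr mul0r.
Qed.

Definition hw_row : 'rV[F]_7 := row7 [:: 1].

(* The SL_2 of the two simple roots clear the last nonzero coordinate one after the other;
   coordinate 3 vanishes by isotropy once 4, 5 and 6 do. *)
Lemma reduce_isotropic (x : 'rV[F]_7) : form x x = 0 ->
  exists2 g, g2_group g & exists c, x *m g^T = c *: hw_row.
Proof.
pose goal (x : 'rV[F]_7) := exists2 g, g2_group g & exists c, x *m g^T = c *: hw_row.
have step (y : 'rV[F]_7) h : g2_group h -> goal (y *m h^T) -> goal y.
  move=> Gh [g Gg [c yc]]; exists (g *m h); first exact: g2_group_mul.
  by exists c; rewrite trmx_mul mulmxA.
have pres (y : 'rV[F]_7) h : g2_group h -> form y y = 0 -> form (y *m h^T) (y *m h^T) = 0.
  by move=> Gh; have [-> _] := g2_group_preserves Gh y y.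
have step2 (y : 'rV[F]_7) h h' : g2_group h -> g2_group h' -> form y y = 0 ->
    (form (y *m h^T *m h'^T) (y *m h^T *m h'^T) = 0 -> goal (y *m h^T *m h'^T)) -> goal y.
  move=> Gh Gh' y0 next; apply: (step _ h) => //; apply: (step _ h') => //.
  exact/next/(pres _ _ Gh')/(pres _ _ Gh).
pose simp := (mulr0, addr0, add0r).
have goal1 a0 a1 : form (row7 [:: a0; a1; 0; 0; 0; 0; 0]) (row7 [:: a0; a1; 0; 0; 0; 0; 0]) = 0 ->
    goal (row7 [:: a0; a1; 0; 0; 0; 0; 0]).
  have [t [s ts]] := sl2_clear a0 a1.
  move=> y0; apply: step2 (g2_group_exp_e 0 t) (g2_group_exp_f 0 s) y0 _ => _.
  rewrite exp_e0_row exp_f0_row ts !simp.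
  exists 1%:M; [exact: g2_group1 | exists (a0 + t * a1)].
  by rewrite trmx1 mulmx1; apply/rowP; elim/ord7P; rewrite row7E // !mxE o7E //= ?mulr1 ?mulr0.
have goal2 a0 a1 a2 (y := row7 [:: a0; a1; a2; 0; 0; 0; 0]) : form y y = 0 -> goal y.
  have [t [s ts]] := sl2_clear a1 a2.
  move=> y0; apply: step2 (g2_group_exp_e 1 t) (g2_group_exp_f 1 s) y0 _.
  by rewrite exp_e1_row exp_f1_row ts !simp; apply: goal1.
have goal3 a0 a1 a2 a3 (y := row7 [:: a0; a1; a2; a3; 0; 0; 0]) : form y y = 0 -> goal y.
  move=> y0; suff a30 : a3 = 0 by rewrite /y a30 in y0 *; apply: goal2.
  move: y0; rewrite /y /form form7_bil /= !row7E //= => y0.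
  have /eqP : 2%:R * (a3 * a3) = 0 by rewrite -[RHS]oppr0 -y0; ring.
  by rewrite !mulf_eq0 pnatr_eq0 orbb => /eqP.
have goal4 a0 a1 a2 a3 a4 (y := row7 [:: a0; a1; a2; a3; a4; 0; 0]) : form y y = 0 -> goal y.
  have [t [s ts]] := sym2_clear a2 a3 a4.
  move=> y0; apply: step2 (g2_group_exp_e 0 t) (g2_group_exp_f 0 s) y0 _.
  by rewrite exp_e0_row exp_f0_row ts !simp; apply: goal3.
have goal5 a0 a1 a2 a3 a4 a5 (y := row7 [:: a0; a1; a2; a3; a4; a5; 0]) : form y y = 0 -> goal y.
  have [t [s ts]] := sl2_clear a4 a5.
  move=> y0; apply: step2 (g2_group_exp_e 1 t) (g2_group_exp_f 1 s) y0 _.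
  by rewrite exp_e1_row exp_f1_row ts; apply: goal4.
rewrite -/(goal x) [x]row7_eta => y0; have [t [s ts]] := sl2_clear (x 0 (o7 5)) (x 0 (o7 6)).
apply: step2 (g2_group_exp_e 0 t) (g2_group_exp_f 0 s) y0 _.
by rewrite exp_e0_row exp_f0_row ts; apply: goal5.
Qed.

End G2Action.

(** * Normal forms, the torus, and highest weight vectors *)

Section G2Orbits.
Variable F : numClosedFieldType.
Local Notation e i := (g2_e F i).
Local Notation f i := (g2_f F i).
Local Notation form x y := ((x *m form7 F *m y^T) 0 0).
Local Notation r0 := (hw_row F).

Definition hw_row1 : 'rV[F]_7 := row7 [:: 0; 1].
(** Its weight is [(1,0) + (-1,1) = (0,1)]: this is the highest weight vector of [g_2] inside
    [Lambda^2 V_7]. *)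
Definition hw_bivector : 'M[F]_7 := wedge r0 hw_row1.
Local Notation r1 := hw_row1.
Local Notation w01 := hw_bivector.

Lemma wedge_mul n m (x y : 'rV[F]_n) (A : 'M[F]_(n, m)) :
  wedge (x *m A) (y *m A) = A^T *m wedge x y *m A.
Proof. by rewrite /wedge !trmx_mul mulmxBr mulmxBl !mulmxA. Qed.

Lemma wedgeZl n c (x y : 'rV[F]_n) : wedge (c *: x) y = c *: wedge x y.
Proof. by apply/matrixP => i j; rewrite wedgeE [RHS]mxE wedgeE !mxE; ring. Qed.

Lemma wedgeZr n c (x y : 'rV[F]_n) : wedge x (c *: y) = c *: wedge x y.
Proof. by apply/matrixP => i j; rewrite wedgeE [RHS]mxE wedgeE !mxE; ring. Qed.

Lemma wedgeDr n (x y z : 'rV[F]_n) : wedge x (y + z) = wedge x y + wedge x z.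
Proof. by apply/matrixP => i j; rewrite wedgeE [RHS]mxE !wedgeE !mxE; ring. Qed.

Lemma hw_row_eta (c : F) : c *: r0 = row7 [:: c; 0; 0; 0; 0; 0; 0].
Proof. by apply/rowP; elim/ord7P; rewrite !mxE !o7E //= ?mulr1 ?mulr0. Qed.

Lemma hw_row1_eta (c : F) : c *: r1 = row7 [:: 0; c; 0; 0; 0; 0; 0].
Proof. by apply/rowP; elim/ord7P; rewrite !mxE !o7E //= ?mulr1 ?mulr0. Qed.

Lemma hw_row_neq0 : r0 != 0.
Proof. by apply/eqP => /rowP/(_ (o7 0)); rewrite row7E // mxE => /eqP; rewrite oner_eq0. Qed.

(** Once [x] is a multiple of [r0], the vanishing cross product leaves only coordinates 0, 1, 2 of
    the second vector. The [SL_2] of the long root fixes [r0] and clears coordinate 2, and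
    coordinate 0 disappears in the wedge. *)
Lemma reduce_pair (x y : 'rV[F]_7) : x != 0 -> form x x = 0 -> cross7 (wedge x y) = 0 ->
  exists g, [/\ g2_group g, exists2 c, c != 0 & x *m g^T = c *: r0
    & exists d, g *m wedge x y *m g^T = d *: w01].
Proof.
move=> x0 xx xy; have [g Gg [c xg]] := reduce_isotropic xx.
have c0 : c != 0.
  apply: contraNneq x0 => c0; move: xg; rewrite c0 scale0r => xg0.
  have ug := g2_group_unit Gg; rewrite -unitmx_tr in ug.
  by apply/eqP/(can_inj (mulmxK ug)); rewrite mul0mx.
have [_] := g2_group_preserves Gg x y; rewrite xy mul0mx xg.
have [z zE] : exists z, y *m g^T = z by exists (y *m g^T).
rewrite zE => cz.
have z3456 : [/\ z 0 (o7 3) = 0, z 0 (o7 4) = 0, z 0 (o7 5) = 0 & z 0 (o7 6) = 0].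
  move/rowP: cz => cz; split; apply: (mulfI c0); rewrite mulr0.
  - have := cz (o7 0); rewrite hw_row_eta /cross7 row7E //= !wedgeE !row7E //= mxE => E.
    by rewrite -[RHS]oppr0 -E; ring.
  - have := cz (o7 1); rewrite hw_row_eta /cross7 row7E //= !wedgeE !row7E //= mxE => E.
    by rewrite -[RHS]oppr0 -E; ring.
  - have := cz (o7 2); rewrite hw_row_eta /cross7 row7E //= !wedgeE !row7E //= mxE => E.
    by rewrite -[RHS]oppr0 -E; ring.
  - have := cz (o7 3); rewrite hw_row_eta /cross7 row7E //= !wedgeE !row7E //= mxE => E.
    by rewrite -[RHS](mulr0 (- 2%:R)) -E; field.
have [t [s ts]] := sl2_clear (z 0 (o7 1)) (z 0 (o7 2)).
pose h := exp_nil (s *: f 1) *m exp_nil (t *: e 1).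
have Gh : g2_group h by apply: g2_group_mul; [exact: g2_group_exp_f | exact: g2_group_exp_e].
have ch : c *: r0 *m h^T = c *: r0.
  by rewrite trmx_mul mulmxA hw_row_eta exp_e1_row exp_f1_row !(mulr0, addr0).
exists (h *m g); split; first exact: g2_group_mul.
  by exists c => //; rewrite trmx_mul mulmxA xg.
exists (c * (z 0 (o7 1) + t * z 0 (o7 2))).
have -> : h *m g *m wedge x y *m (h *m g)^T = wedge (x *m g^T *m h^T) (y *m g^T *m h^T).
  by rewrite !wedge_mul !trmxK trmx_mul !mulmxA.
rewrite xg zE ch [z]row7_eta; case: z3456 => -> -> -> ->.
rewrite trmx_mul mulmxA exp_e1_row exp_f1_row ts !(mulr0, addr0).
rewrite wedgeZl -scalerA; congr (_ *: _).
have -> : row7 [:: z 0 (o7 0); z 0 (o7 1) + t * z 0 (o7 2); 0; 0; 0; 0; 0] =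
    z 0 (o7 0) *: r0 + (z 0 (o7 1) + t * z 0 (o7 2)) *: r1.
  by rewrite hw_row_eta hw_row1_eta; apply/rowP; elim/ord7P; rewrite !mxE !o7E //= ?addr0 ?add0r.
have rr : wedge r0 r0 = 0 by rewrite /wedge subrr.
by rewrite wedgeDr !wedgeZr rr scaler0 add0r !row7E. 
Qed.

(** Fundamental weights are dual to simple coroots, so the coroot elements at [s] and [t] scale the
    two highest weight vectors independently. *)
Lemma torus (s t : F) : s != 0 -> t != 0 ->
  exists g, [/\ g2_group g, r0 *m g^T = s *: r0 & g *m w01 *m g^T = t *: w01].
Proof.
move=> s0 t0.
(* [w k u] represents a simple reflection, and [w k u *m w k (- 1)] is the [k]-th simple coroot
   evaluated at [u]. *)
pose w k u := exp_nil (u *: e k) *m exp_nil (- u^-1 *: f k) *m exp_nil (u *: e k).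
have Gw k u : g2_group (w k u).
  apply: g2_group_mul (g2_group_exp_e k u); apply: g2_group_mul (g2_group_exp_f k _).
  exact: g2_group_exp_e.
have w0 u a b : u != 0 -> row7 [:: a; b; 0; 0; 0; 0; 0] *m (w 0 u)^T =
    row7 [:: u * b; - u^-1 * a; 0; 0; 0; 0; 0].
  move=> u0; rewrite !trmx_mul !mulmxA exp_e0_row exp_f0_row exp_e0_row.
  by apply/rowP; elim/ord7P; rewrite !row7E //=; field.
have w1 u a b : u != 0 -> row7 [:: a; b; 0; 0; 0; 0; 0] *m (w 1 (- 1))^T *m (w 1 u)^T =
    row7 [:: a; u * b; 0; 0; 0; 0; 0].
  move=> u0; rewrite !trmx_mul !mulmxA exp_e1_row exp_f1_row
    exp_e1_row exp_e1_row exp_f1_row exp_e1_row.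
  by apply/rowP; elim/ord7P; rewrite !row7E //=; field.
have N1 : - 1 != 0 :> F by rewrite oppr_eq0 oner_eq0.
pose g := w 1 t *m w 1 (- 1) *m (w 0 s *m w 0 (- 1)).
have tr4 (A B C D : 'M[F]_7) (x : 'rV[F]_7) :
    x *m (A *m B *m (C *m D))^T = x *m D^T *m C^T *m B^T *m A^T.
  by rewrite !trmx_mul !mulmxA.
have gE a b : row7 [:: a; b; 0; 0; 0; 0; 0] *m g^T = row7 [:: s * a; t * (s^-1 * b); 0; 0; 0; 0; 0].
  rewrite /g tr4 (w0 _ _ _ N1) (w0 _ _ _ s0) (w1 _ _ _ t0).
  by apply/rowP; elim/ord7P; rewrite !row7E //=; field.
have Gg : g2_group g.
  exact: g2_group_mul (g2_group_mul (Gw _ _) (Gw _ _)) (g2_group_mul (Gw _ _) (Gw _ _)).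
exists g; split=> //.
  by have := gE 1 0; rewrite !mulr0 mulr1 -!hw_row_eta scale1r.
have r1g : r1 *m g^T = (t * s^-1) *: r1.
  by have := gE 0 1; rewrite !mulr0 mulr1 -!hw_row1_eta scale1r.
have r0g : r0 *m g^T = s *: r0.
  by have := gE 1 0; rewrite !mulr0 mulr1 -!hw_row_eta scale1r.
have -> : g *m w01 *m g^T = wedge (r0 *m g^T) (r1 *m g^T) by rewrite wedge_mul trmxK.
by rewrite r0g r1g wedgeZl wedgeZr !scalerA; congr (_ *: _); field.
Qed.

Lemma g2_group_form (g : 'M[F]_7) : g2_group g -> g^T *m form7 F *m g = form7 F.
Proof.
move=> Gg; apply/matrixP => i j.
have [+ _] := g2_group_preserves Gg (delta_mx 0 i) (delta_mx 0 j).
have deltaE (A : 'M[F]_7) :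
    ((delta_mx 0 i : 'rV[F]_7) *m A *m (delta_mx 0 j : 'rV[F]_7)^T) 0 0 = A i j.
  by rewrite -rowE trmx_delta -colE !mxE.
by rewrite trmx_mul trmxK => H; rewrite -[LHS]deltaE -[RHS]deltaE -H !mulmxA.
Qed.

(** Multiplication by [form7] identifies bivectors with skew endomorphisms; as [g] preserves the
    form, conjugation becomes the natural action on bivectors. *)
Lemma g2_group_conj (g w : 'M[F]_7) : g2_group g ->
  g *m (w *m form7 F) *m invmx g = g *m w *m g^T *m form7 F.
Proof.
move=> Gg; have ug := g2_group_unit Gg.
by apply: (can_inj (mulmxK ug)); rewrite mulmxKV // -!mulmxA (mulmxA g^T) g2_group_form.
Qed.

Lemma killed_by_positive_roots (x : 'rV[F]_7) :
  x *m (e 0)^T = 0 -> x *m (e 1)^T = 0 -> x = x 0 (o7 0) *: r0.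
Proof.
move=> e0x e1x; rewrite hw_row_eta {1}[x]row7_eta.
rewrite (row7_eta x) e0_row in e0x; rewrite (row7_eta x) e1_row in e1x.
move/rowP: e0x => e0x; move/rowP: e1x => e1x.
have h1 := e0x (o7 0); have h3 := e0x (o7 2); have h4 := e0x (o7 3); have h6 := e0x (o7 5).
have h2 := e1x (o7 1); have h5 := e1x (o7 4).
rewrite row7E //= mxE in h1; rewrite row7E //= mxE in h2; rewrite row7E //= mxE in h3.
rewrite row7E //= mxE in h4; rewrite row7E //= mxE in h5; rewrite row7E //= mxE in h6.
move/eqP: h3; rewrite mulf_eq0 pnatr_eq0 /= => /eqP h3.
by rewrite h1 h2 h3 h4 h5 h6.
Qed.

Lemma hw_vector_V7P (v : 'cV[F]_7) : hw_vector_V7 v ->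
  exists2 c, c != 0 & v = (c *: r0)^T.
Proof.
case=> v0 ev.
have vE : v = (v^T 0 (o7 0) *: r0)^T.
  by rewrite -killed_by_positive_roots ?trmxK // -trmx_mul (ev _).1 trmx0.
exists (v^T 0 (o7 0)) => //; apply: contraNneq v0 => x0.
by rewrite vE x0 scale0r trmx0.
Qed.

(* The eigenvalues of [g2_h F 0] and [g2_h F 1], shifted by 2 and 1 to be natural numbers. *)
Definition weight0 : seq nat := [:: 3; 1; 4; 2; 0; 3; 1]%N.
Definition weight1 : seq nat := [:: 1; 2; 0; 1; 2; 0; 1]%N.

Lemma g2_hE i : g2_h F i =
  diag_mx (\row_(k < 7) if i == 0 then (nth 0%N weight0 k)%:R - 2%:R
                         else (nth 0%N weight1 k)%:R - 1).
Proof.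
apply: trmx_inj; rewrite tr_diag_mx; apply: mulmx_row_inj => x.
rewrite /g2_h /lie7 linearB /= !trmx_mul mulmxBr !mulmxA [x]row7_eta.
elim/ord2P: i; [rewrite e0_row f0_row f0_row e0_row | rewrite e1_row f1_row f1_row e1_row];
apply/rowP; elim/ord7P; rewrite mul_mx_diag !mxE !o7E //=; ring.
Qed.

(** The entry [(i, j)] has weight the difference of the weights of [i] and [j], and only [(0, 5)]
    and [(1, 6)] have weight [(0,1)]. Commutation with [g2_e F 0] ties these two entries
    together. *)
Lemma hw_vector_g2P (x : 'M[F]_7) : hw_vector_g2 x ->
  exists2 d, d != 0 & x = d *: (w01 *m form7 F).
Proof.
case=> _ x0 hx.
have wt i j : (i < 7)%N -> (j < 7)%N ->
    (nth 0 weight0 i != nth 0 weight0 j)%N || (nth 0 weight1 i != (nth 0 weight1 j).+1)%N ->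
    x (o7 i) (o7 j) = 0.
  move=> i7 j7; have [_ h0] := hx 0; have [_ h1] := hx 1.
  rewrite g2_hE /lie7 mul_diag_mx mul_mx_diag in h0; move/matrixP/(_ (o7 i) (o7 j)): h0.
  rewrite g2_hE /lie7 mul_diag_mx mul_mx_diag in h1; move/matrixP/(_ (o7 i) (o7 j)): h1.
  rewrite !mxE !o7E //= => h1 h0.
  case/orP => ne; apply: contra_neq_eq ne => xij; apply/eqP; rewrite -(eqr_nat F);
    apply/eqP/(mulIf xij)/eqP; rewrite -subr_eq0 -1?[X in _ == X]h0; apply/eqP.
    by rewrite -[RHS](mul0r (x (o7 i) (o7 j))) -h0; ring.
  by rewrite -[RHS](subrr (x (o7 i) (o7 j))) -{3}[x (o7 i) (o7 j)]mul1r -h1 -natr1; ring.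
have x16 : x (o7 1) (o7 6) = x (o7 0) (o7 5).
  have [/matrixP/(_ (o7 0) (o7 6)) + _] := hx 0.
  rewrite /lie7 !mxE !sum7 /g2_e /= !mxE !o7E //= => h.
  by apply/eqP; rewrite -subr_eq0 -[X in _ == X]h; apply/eqP; ring.
have r0S : r0 *m form7 F = row7 [:: 0; 0; 0; 0; 0; 0; 1].
  by apply/rowP; elim/ord7P; rewrite mxE sum7 !mxE !o7E //=; ring.
have r1S : r1 *m form7 F = row7 [:: 0; 0; 0; 0; 0; - 1].
  by apply/rowP; elim/ord7P; rewrite mxE sum7 !mxE !o7E //=; ring.
have wS i j : (w01 *m form7 F) i j =
    r0 0 i * row7 [:: 0; 0; 0; 0; 0; - 1] 0 j - r1 0 i * row7 [:: 0; 0; 0; 0; 0; 0; 1] 0 j.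
  rewrite /hw_bivector /wedge mulmxBl -!mulmxA r0S r1S [LHS]mxE [X in _ + X]mxE.
  by rewrite [in LHS]mxE big_ord1 [(r1^T *m _) _ _]mxE big_ord1 !(mxE trmx_key).
have xE : x = - x (o7 0) (o7 5) *: (w01 *m form7 F).
  have xE i j : (i < 7)%N -> (j < 7)%N -> x (o7 i) (o7 j) =
      - x (o7 0) (o7 5) * (nth 0 [:: 1] i * nth 0 [:: 0; 0; 0; 0; 0; - 1] j
                         - nth 0 [:: 0; 1] i * nth 0 [:: 0; 0; 0; 0; 0; 0; 1] j).
    move=> i7 j7; move: i j i7 j7 (wt i j i7 j7) =>
      [|[|[|[|[|[|[|//]]]]]]] [|[|[|[|[|[|[|//]]]]]]] _ _ wij;
      rewrite ?x16; try rewrite (wij isT); rewrite /=; ring.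
  apply/matrixP => i j; rewrite [RHS]mxE wS /hw_row /hw_row1.
  by elim/ord7P: i; elim/ord7P: j; rewrite [LHS]xE // !row7E.
exists (- x (o7 0) (o7 5)) => //; apply: contra_neq x0 => x05.
by rewrite xE x05 scale0r.
Qed.

End G2Orbits.

(** * The horospherical variety *)

Section ZariskiClosure.
Variable F : numClosedFieldType.

Definition linear_mpoly n (l : 'I_n -> F) : {mpoly F[n]} := \sum_i l i *: 'X_i.

Lemma linear_mpoly_homog n (l : 'I_n -> F) : linear_mpoly l \is 1.-homog.
Proof. by apply: rpred_sum => i _; apply: rpredZ; rewrite dhomogX /= mdeg1. Qed.

Lemma meval_linear_mpoly n (l v : 'I_n -> F) :
  (linear_mpoly l).@[v] = \sum_i l i * v i.
Proof.
rewrite /linear_mpoly raddf_sum; apply: eq_bigr => i _.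
by rewrite /= mevalZ mevalXU.
Qed.

Definition matrix_mpoly n m (A : 'M[F]_(n, m)) (j : 'I_m) : {mpoly F[n]} :=
  linear_mpoly (A^~ j).

Lemma meval_matrix_mpoly n m (A : 'M[F]_(n, m)) j (x : 'rV[F]_n) :
  (matrix_mpoly A j).@[x 0] = (x *m A) 0 j.
Proof. by rewrite meval_linear_mpoly mxE; apply: eq_bigr => i _; rewrite mulrC. Qed.

Lemma comp_mpoly_homog n m d (P : {mpoly F[m]}) (q : m.-tuple {mpoly F[n]}) :
  P \is d.-homog -> (forall i, tnth q i \is 1.-homog) -> P \mPo q \is d.-homog.
Proof.
move=> homP homq; rewrite comp_mpolyEX big_seq; apply: rpred_sum => k kP; apply: rpredZ.
have <- : mdeg k = d by apply: (dhomog_mf homP).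
rewrite comp_mpolyX mdegE; elim/big_ind2: _ => [|d1 p1 d2 p2 h1 h2|i _].
- exact: dhomog1.
- exact: dhomogM.
- by have := dhomogMn (k i) (homq i); rewrite mul1n.
Qed.

Lemma closure_linear n (X : 'rV[F]_n -> Prop) (A : 'M[F]_n) p :
  (forall y, X y -> X (y *m A)) -> zariski_closure X p -> p *m A != 0 ->
  zariski_closure X (p *m A).
Proof.
move=> XA [p0 Xp] pA0; split=> // d P homP PX.
pose q := [tuple matrix_mpoly A j | j < n].
have PqE (y : 'rV[F]_n) : (P \mPo q).@[y 0] = P.@[(y *m A) 0].
  rewrite comp_mpoly_meval; apply: meval_eq => j.
  by rewrite tnth_mktuple meval_matrix_mpoly.
rewrite -PqE; apply: (Xp d) => [|y Xy]; last by rewrite PqE; apply/PX/XA.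
by apply: comp_mpoly_homog => // j; rewrite tnth_mktuple linear_mpoly_homog.
Qed.

Lemma poly_eq0_of_horner (q : {poly F}) : (forall t, t != 0 -> q.[t] = 0) -> q = 0.
Proof.
move=> q0; apply/eqP; apply: contraT => qn0.
(* The integers 1 to [size q] are distinct and nonzero in characteristic 0: more roots than the
   degree allows. *)
pose rs : seq F := [seq i.+1%:R | i <- iota 0 (size q)].
have : (size rs < size q)%N.
  apply: max_poly_roots qn0 _ _.
    by apply/allP => _ /mapP[i _ ->]; rewrite /root q0 // pnatr_eq0.
  rewrite map_inj_in_uniq ?iota_uniq // => i j _ _ /eqP.
  by rewrite eqr_nat eqSS => /eqP.
by rewrite size_map size_iota ltnn.
Qed.

(** Restricted to the line, a form vanishing on [X] is a polynomial in [t] with every nonzero [t] as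
    a root, hence zero also at [t = 0]. *)
Lemma closure_line n (X : 'rV[F]_n -> Prop) (a b : 'rV[F]_n) :
  a != 0 -> (forall t, t != 0 -> X (a + t *: b)) -> zariski_closure X a.
Proof.
move=> a0 Xab; split=> // d P _ PX.
pose q : {poly F} :=
  \sum_(m <- msupp P) P@_m *: \prod_i ((a 0 i)%:P + b 0 i *: 'X) ^+ m i.
have qE t : q.[t] = P.@[(a + t *: b) 0].
  rewrite mevalE horner_sum; apply: eq_bigr => m _; rewrite hornerZ horner_prod.
  congr (_ * _); apply: eq_bigr => i _.
  by rewrite horner_exp hornerD hornerC hornerZ hornerX !mxE mulrC.
have q0 : q = 0 by apply: poly_eq0_of_horner => t t0; rewrite qE PX //; apply: Xab.
by have := qE 0; rewrite q0 horner0 scale0r addr0 => <-.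
Qed.

End ZariskiClosure.

Section Forms.
Variable F : numClosedFieldType.

(** Forms as functions: the equations can then be written directly in the entries of a bivector,
    without exhibiting polynomials. *)
Definition is_form n d (f : 'rV[F]_n -> F) :=
  exists2 P : {mpoly F[n]}, P \is d.-homog & forall x : 'rV[F]_n, P.@[x 0] = f x.

Lemma is_formD n d (f g : 'rV[F]_n -> F) :
  is_form d f -> is_form d g -> is_form d (fun x => f x + g x).
Proof.
move=> [P hP fP] [Q hQ gQ]; exists (P + Q); first exact: rpredD.
by move=> x; rewrite mevalD fP gQ.
Qed.

Lemma is_formN n d (f : 'rV[F]_n -> F) : is_form d f -> is_form d (fun x => - f x).
Proof.
move=> [P hP fP]; exists (- P); first by rewrite rpredN.
by move=> x; rewrite mevalN fP.
Qed.

Lemma is_formM n d k (f g : 'rV[F]_n -> F) :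
  is_form d f -> is_form k g -> is_form (d + k) (fun x => f x * g x).
Proof.
move=> [P hP fP] [Q hQ gQ]; exists (P * Q); first exact: dhomogM.
by move=> x; rewrite mevalM fP gQ.
Qed.

Lemma is_form_sum n d (I : finType) (f : I -> 'rV[F]_n -> F) :
  (forall i, is_form d (f i)) -> is_form d (fun x => \sum_i f i x).
Proof.
move=> hf; have [P] : exists P : I -> {mpoly F[n]},
    forall i, P i \is d.-homog /\ forall x : 'rV[F]_n, (P i).@[x 0] = f i x.
  apply: (fin_all_exists (P := fun i Q =>
    Q \is d.-homog /\ forall x : 'rV[F]_n, Q.@[x 0] = f i x)) => i.
  by have [Q hQ fQ] := hf i; exists Q.
move=> PP; exists (\sum_i P i); first by apply: rpred_sum => i _; case: (PP i).
move=> x; rewrite raddf_sum; apply: eq_bigr => i _; have [_ PiE] := PP i; exact: PiE.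
Qed.

Definition is_linear n m (f : 'rV[F]_n -> 'rV[F]_m) :=
  forall a x y, f (a *: x + y) = a *: f x + f y.

Lemma is_linearE n m (f : 'rV[F]_n -> 'rV[F]_m) : is_linear f ->
  forall x, f x = x *m \matrix_i f (delta_mx 0 i).
Proof.
move=> lf x; have f0 : f 0 = 0.
  by have := lf (-1) 0 0; rewrite scaler0 add0r scaleN1r addNr.
rewrite {1}[x]row_sum_delta mulmx_sum_row.
apply: (big_ind2 (fun u v => f u = v)) => [//|x1 y1 x2 y2 <- <-|i _].
  by have := lf 1 x1 x2; rewrite !scale1r.
by rewrite rowK; have := lf (x 0 i) (delta_mx 0 i) 0; rewrite f0 !addr0.
Qed.

Lemma is_form_linear n m (f : 'rV[F]_n -> 'rV[F]_m) j : is_linear f ->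
  is_form 1 (fun x => f x 0 j).
Proof.
move=> lf; exists (matrix_mpoly (\matrix_i f (delta_mx 0 i)) j).
  exact: linear_mpoly_homog.
by move=> x; rewrite meval_matrix_mpoly -is_linearE.
Qed.

Lemma is_form_closure n d (f : 'rV[F]_n -> F) (X : 'rV[F]_n -> Prop) x :
  is_form d f -> (forall y, X y -> f y = 0) -> zariski_closure X x -> f x = 0.
Proof.
move=> [P hP fP] fX [_ Xx]; rewrite -fP; apply: (Xx d) => // y Xy.
by rewrite fP fX.
Qed.

Lemma linear_morphism n m (X : 'rV[F]_n -> Prop) (Y : 'rV[F]_m -> Prop)
    (f : 'rV[F]_n -> 'rV[F]_m) : is_linear f ->
  (forall x, X x -> Y (f x)) -> (forall x, X x -> f x != 0) -> is_morphism X Y f.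
Proof.
move=> lf fXY f0; split=> // x Xx; pose A := \matrix_i f (delta_mx 0 i).
have polyE y : poly_map (matrix_mpoly A) y = f y.
  by apply/rowP => j; rewrite mxE meval_matrix_mpoly -is_linearE.
exists 1%N, (matrix_mpoly A); split=> [j||y _ _].
- exact: linear_mpoly_homog.
- by rewrite polyE f0.
- by rewrite polyE; exists 1; rewrite ?oner_eq0 ?scale1r.
Qed.

Lemma row_free2 n (U : 'M[F]_(2, n)) : row_free U = (wedge (row 0 U) (row 1 U) != 0).
Proof.
have rowE2 (c : 'rV[F]_2) : c *m U = c 0 0 *: row 0 U + c 0 1 *: row 1 U.
  rewrite mulmx_sum_row !big_ord_recl big_ord0 addr0.
  by have -> : lift ord0 ord0 = 1 :> 'I_2 by apply/val_inj.
have wxx (x : 'rV[F]_n) : wedge x x = 0 by rewrite /wedge subrr.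
have wC (x y : 'rV[F]_n) : wedge y x = - wedge x y by rewrite /wedge opprB.
apply/idP/idP => [freeU|w0].
  apply/eqP => w0; have wE i j : U 0 i * U 1 j = U 1 i * U 0 j.
    by have /matrixP/(_ i j)/eqP := w0; rewrite wedgeE !mxE subr_eq0 => /eqP.
  have U0 i : U 0 i = 0.
    pose c : 'rV[F]_2 := \row_k (if k == 0 then - U 1 i else U 0 i).
    have c0 : c = 0.
      apply: (can_inj (mulmxKp freeU)); rewrite mul0mx rowE2 !mxE /=.
      by apply/rowP => j; rewrite !mxE wE mulNr addNr.
    by have /rowP/(_ 1) := c0; rewrite !mxE.
  have := mulmxKp freeU (delta_mx 0 0 : 'rV_2); rewrite -rowE.
  have -> : row 0 U = 0 by apply/rowP => j; rewrite !mxE U0.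
  by rewrite mul0mx => /rowP/(_ 0)/eqP; rewrite !mxE eqxx eq_sym oner_eq0.
rewrite -kermx_eq0; apply/eqP/row_matrixP => i; rewrite row0.
have /sub_kermxP := row_sub i (kermx U); move: (row i _) => c; rewrite rowE2 => cU.
have c0 : c 0 0 = 0.
  have := congr1 (fun x => wedge (row 1 U) x) cU.
  rewrite wedgeDr !wedgeZr wxx scaler0 addr0 wC => /eqP.
  rewrite /wedge trmx0 mulmx0 mul0mx subrr scaler_eq0 oppr_eq0 (negPf w0) orbF.
  by move/eqP.
have c1 : c 0 1 = 0.
  have := congr1 (fun x => wedge (row 0 U) x) cU.
  rewrite wedgeDr !wedgeZr wxx scaler0 add0r => /eqP.
  rewrite /wedge trmx0 mulmx0 mul0mx subrr scaler_eq0 (negPf w0) orbF.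
  by move/eqP.
apply/rowP => k; rewrite [RHS]mxE; elim/ord2P: k; [exact: c0 | exact: c1].
Qed.

End Forms.

(** * Equations of the horospherical variety *)

Section Horospherical.
Variable F : numClosedFieldType.
Local Notation r0 := (hw_row F).
Local Notation r1 := (hw_row1 F).
Local Notation w01 := (hw_bivector F).

(* The bivector [w + v /\ e] of [V_7 (+) <e>]. *)
Definition bivector8 (v : 'rV[F]_7) (w : 'M[F]_7) : 'M[F]_(7 + 1) := block_mx w v^T (- v) 0.

(* The point [v + w] of V_7 (+) g_2, the bivector [w] being viewed as a matrix via the form. *)
Definition point (v : 'rV[F]_7) (w : 'M[F]_7) : 'rV[F]_(7 + 7 * 7) :=
  row_mx v (mxvec (w *m form7 F)).

Definition bivector_of_point (p : 'rV[F]_(7 + 7 * 7)) : 'M[F]_(7 + 1) :=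
  bivector8 (lsubmx p) (vec_mx (rsubmx p) *m invmx (form7 F)).

Definition point_of_bivector (M : 'M[F]_(7 + 1)) : 'rV[F]_(7 + 7 * 7) :=
  point (ursubmx M)^T (ulsubmx M).

Lemma bivector_of_pointK v w : bivector_of_point (point v w) = bivector8 v w.
Proof.
by rewrite /bivector_of_point row_mxKl row_mxKr mxvecK mulmxK ?form7_unit.
Qed.

Lemma point_of_bivectorK p : point_of_bivector (bivector_of_point p) = p.
Proof.
rewrite /point_of_bivector /bivector_of_point /bivector8 block_mxKul block_mxKur trmxK /point.
by rewrite mulmxKV ?form7_unit // vec_mxK hsubmxK.
Qed.

Lemma bivector8_eq0 v w : (bivector8 v w == 0) = (v == 0) && (w == 0).
Proof.
apply/eqP/andP => [vw0|[/eqP-> /eqP->]]; last first.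
  rewrite /bivector8 trmx0 oppr0; apply/matrixP => i j; rewrite !mxE.
  by case: splitP => ?; rewrite mxE; case: splitP => ?; rewrite mxE.
have wE : ulsubmx (bivector8 v w) = w by rewrite block_mxKul.
have vE : (ursubmx (bivector8 v w))^T = v by rewrite block_mxKur trmxK.
rewrite vw0 in vE wE; rewrite -vE -wE; split; apply/eqP/matrixP => i j; by rewrite !mxE.
Qed.

Lemma point00 : point 0 0 = 0.
Proof. by rewrite /point mul0mx linear0 row_mx0. Qed.

Lemma point_of_bivector_linear a (M N : 'M[F]_(7 + 1)) :
  point_of_bivector (a *: M + N) = a *: point_of_bivector M + point_of_bivector N.
Proof.
have ulE : ulsubmx (a *: M + N) = a *: ulsubmx M + ulsubmx N.
  by apply/matrixP => i j; rewrite !mxE.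
have urE : ursubmx (a *: M + N) = a *: ursubmx M + ursubmx N.
  by apply/matrixP => i j; rewrite !mxE.
rewrite /point_of_bivector /point ulE urE linearD linearZ /= mulmxDl -scalemxAl linearD linearZ /=.
by rewrite scale_row_mx add_row_mx.
Qed.

Lemma point_of_bivector0 : point_of_bivector 0 = 0.
Proof.
have <- : bivector8 0 0 = 0 by apply/eqP; rewrite bivector8_eq0 !eqxx.
by rewrite -bivector_of_pointK point_of_bivectorK point00.
Qed.

Lemma wedge8E (u0 u1 : 'rV[F]_(7 + 1)) : wedge u0 u1 =
  bivector8 (rsubmx u1 0 0 *: lsubmx u0 - rsubmx u0 0 0 *: lsubmx u1)
            (wedge (lsubmx u0) (lsubmx u1)).
Proof.
rewrite /wedge /bivector8 -{1 2}[u0]hsubmxK -{1 2}[u1]hsubmxK !tr_row_mx !mul_col_row.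
rewrite opp_block_mx add_block_mx; congr block_mx.
- rewrite {1}[rsubmx u1]mx11_scalar {1}[rsubmx u0]mx11_scalar !mul_mx_scalar.
  by rewrite linearB !linearZ.
- rewrite {1}[rsubmx u1]mx11_scalar {1}[rsubmx u0]mx11_scalar !tr_scalar_mx !mul_scalar_mx.
  by rewrite opprB.
- by apply/matrixP => i j; rewrite !ord1 !mxE !big_ord1 !mxE mulrC subrr.
Qed.

Definition null_plane (u0 u1 : 'rV[F]_(7 + 1)) : Prop :=
  [/\ bil (form8 F) u0 u0 = 0, bil (form8 F) u0 u1 = 0, bil (form8 F) u1 u1 = 0
    & null8 u0 u1].

(** Dependent pairs are allowed, so 0 is a null point and [p != 0] is stated separately. *)
Definition null_point p := exists u0 u1, null_plane u0 u1 /\ bivector_of_point p = wedge u0 u1.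

Lemma is_form_bivector i j : is_form 1 (fun p => bivector_of_point p i j).
Proof.
pose f (p : 'rV[F]_(7 + 7 * 7)) := mxvec (bivector_of_point p).
have lf : is_linear f.
  move=> a x y; rewrite /f -linearZ -linearD; congr mxvec.
  rewrite /bivector_of_point /bivector8 !linearD !linearZ /= scale_block_mx add_block_mx.
  by rewrite mulmxDl -scalemxAl scaler0 addr0.
have [P hP fP] := is_form_linear (mxvec_index i j) lf.
by exists P => // x; rewrite fP mxvecE.
Qed.

(** Null points satisfy the Plucker relations, the quadratic isotropy of the rows, and the linear
    equations [cross7 = 0]. These pass to the closure, and any nonzero solution comes from a plane
    again. *)
Lemma closure_null_point (X : 'rV[F]_(7 + 7 * 7) -> Prop) p :
  (forall q, X q -> null_point q) -> zariski_closure X p -> null_point p.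
Proof.
move=> XZ Xp; have p0 := Xp.1.
pose Z q := forall f d, is_form d f -> (forall q, null_point q -> f q = 0) -> f q = 0 :> F.
have {}Xp : Z p by move=> f d hf fX; apply: is_form_closure hf _ Xp => q /XZ; apply: fX.
pose M := bivector_of_point p.
have plucker i j k l : M i j * M k l = M i k * M j l - M i l * M j k.
  apply/eqP; rewrite -subr_eq0; apply/eqP.
  apply: (Xp (fun q => let N := bivector_of_point q in
      N i j * N k l - (N i k * N j l - N i l * N j k)) (1 + 1)%N).
    apply: is_formD; first by apply: is_formM; apply: is_form_bivector.
    apply: is_formN; apply: is_formD; [|apply: is_formN];
      by apply: is_formM; apply: is_form_bivector.
  by move=> q [u0 [u1 [_ /= ->]]]; rewrite !wedgeE; ring.
have iso i j : bil (form8 F) (row i M) (row j M) = 0.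
  have bilE (N : 'M[F]_(7 + 1)) : bil (form8 F) (row i N) (row j N) =
     \sum_a \sum_b N i a * (form8 F a b * N j b).
    rewrite /bil mxE; under eq_bigr => b _ do rewrite mxE mulr_suml.
    rewrite exchange_big; apply: eq_bigr => a _; apply: eq_bigr => b _.
    by rewrite !mxE mulrA.
  rewrite bilE.
  apply: (Xp (fun q =>
    \sum_a \sum_b bivector_of_point q i a * (form8 F a b * bivector_of_point q j b)) (1 + 1)%N).
    apply: is_form_sum => a; apply: is_form_sum => b.
    apply: is_formM; first exact: is_form_bivector.
    have [P hP fP] := is_form_bivector j b; exists (form8 F a b *: P); first exact: rpredZ.
    by move=> x; rewrite mevalZ fP.
  move=> q [u0 [u1 [[q00 q01 q11 _] qE]]]; rewrite -bilE qE.
  have rowE k : row k (wedge u0 u1) = u0 0 k *: u1 - u1 0 k *: u0.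
    by apply/rowP => l; rewrite mxE wedgeE !mxE.
  rewrite !rowE !(bilDl, bilDr, bilNl, bilNr, bilZl, bilZr) q00 q01 q11.
  have -> : bil (form8 F) u1 u0 = 0.
    by rewrite bilC // /form8 tr_block_mx form7_sym !trmx0.
  ring.
have null k : cross7 (ulsubmx M) 0 k = 0.
  apply: (Xp (fun q => cross7 (ulsubmx (bivector_of_point q)) 0 k) 1%N).
    have sub i j : is_form 1 (fun q => ulsubmx (bivector_of_point q) i j).
      have [P hP fP] := is_form_bivector (lshift 1 i) (lshift 1 j).
      by exists P => // x; rewrite fP !mxE.
    have dif i j k' l : is_form 1 (fun q => ulsubmx (bivector_of_point q) (o7 i) (o7 j)
        - ulsubmx (bivector_of_point q) (o7 k') (o7 l)).
      by apply: is_formD; [|apply: is_formN]; apply: sub.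
    have entry f : is_form 1 f -> (forall q, f q = cross7 (ulsubmx (bivector_of_point q)) 0 k) ->
        is_form 1 (fun q => cross7 (ulsubmx (bivector_of_point q)) 0 k).
      by move=> [P hP fP] fE; exists P => // x; rewrite fP fE.
    move: k entry; elim/ord7P => entry.
    - by apply: entry (dif 1 2 0 3)%N _ => q; rewrite /cross7 row7E.
    - by apply: entry (dif 1 3 0 4)%N _ => q; rewrite /cross7 row7E.
    - by apply: entry (dif 2 3 0 5)%N _ => q; rewrite /cross7 row7E.
    - have [P hP fP] := is_formD (dif 2 4 0 6)%N (is_formN (sub (o7 1) (o7 5))).
      exists (2%:R^-1 *: P); first exact: rpredZ.
      by move=> q; rewrite mevalZ fP /cross7 row7E.
    - by apply: entry (dif 3 4 1 6)%N _ => q; rewrite /cross7 row7E.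
    - by apply: entry (dif 3 5 2 6)%N _ => q; rewrite /cross7 row7E.
    - by apply: entry (dif 4 5 3 6)%N _ => q; rewrite /cross7 row7E.
  move=> q [u0 [u1 [[_ _ _ null01] ->]]].
  by rewrite wedge8E block_mxKul null01 mxE.
have [i [j Mij]] : exists i, exists j, M i j != 0.
  have : M != 0.
    by apply: contraNneq p0 => M0; rewrite -[p]point_of_bivectorK -/M M0 point_of_bivector0.
  have [/existsP[i /existsP[j Mij]] _|/existsPn nM /eqP[]] :=
    boolP [exists i, exists j, M i j != 0]; first by exists i, j.
  by apply/matrixP => i j; have /existsPn/(_ j)/negPn/eqP-> := nM i; rewrite mxE.
have pM : bivector_of_point p = M by [].
(* By the Plucker relations, two rows meeting in a nonzero entry [M i j] span the plane, and
   dividing by this entry recovers [M] exactly. *)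
clearbody M; exists ((M i j)^-1 *: row i M), (row j M); rewrite pM.
have ME : M = wedge ((M i j)^-1 *: row i M) (row j M).
  apply/matrixP => k l; rewrite wedgeZl mxE wedgeE !mxE -(mulrC (M i l)) -plucker.
  by rewrite mulKf.
split=> //; split; rewrite ?bilZl ?bilZr ?iso ?mulr0 //.
have wM : ulsubmx M = wedge (lsubmx ((M i j)^-1 *: row i M)) (lsubmx (row j M)).
  by rewrite {1}ME wedge8E block_mxKul.
by rewrite /null8 -wM; apply/rowP => k; rewrite null mxE.
Qed.

Local Notation form x y := ((x *m form7 F *m y^T) 0 0).

Lemma cross7Z a (w : 'M[F]_7) : cross7 (a *: w) = a *: cross7 w.
Proof. by apply/rowP; elim/ord7P; rewrite /cross7 row7E //= [RHS]mxE row7E //= !mxE; ring. Qed.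

Lemma form_hw : [/\ form r0 r0 = 0, form r0 r1 = 0, form r1 r1 = 0 & cross7 w01 = 0].
Proof.
split; try by rewrite form7_bil /= !row7E //=; ring.
by apply/rowP; elim/ord7P; rewrite /cross7 row7E //= /hw_bivector !wedgeE !row7E //= mxE; ring.
Qed.

Lemma sum_coord_point v w : sum_coord v^T (w *m form7 F) = point v w.
Proof. by rewrite /sum_coord trmxK. Qed.

Lemma point_eq0 v w : (point v w == 0) = (v == 0) && (w == 0).
Proof.
rewrite -bivector8_eq0 -bivector_of_pointK; apply/eqP/eqP => [->|pb0].
  rewrite -point00 bivector_of_pointK; apply/eqP.
  by rewrite bivector8_eq0 !eqxx.
by rewrite -[LHS]point_of_bivectorK pb0 point_of_bivector0.
Qed.

Variables c d : F.
Hypotheses (c0 : c != 0) (d0 : d != 0).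
Let v1 : 'cV[F]_7 := (c *: r0)^T.
Let v2 : 'M[F]_7 := d *: (w01 *m form7 F).

Lemma g2_orbitP p : g2_orbit v1 v2 p <->
  exists2 g, g2_group g & p = point (c *: (r0 *m g^T)) (d *: (g *m w01 *m g^T)).
Proof.
have E g : g2_group g -> sum_coord (g *m v1) (g *m v2 *m invmx g) =
    point (c *: (r0 *m g^T)) (d *: (g *m w01 *m g^T)).
  move=> Gg; rewrite /v1 /v2 scalemxAl g2_group_conj // -[g in g *m _^T]trmxK -trmx_mul.
  by rewrite sum_coord_point -scalemxAl -scalemxAr -scalemxAl.
by split=> [[g Gg ->]|[g Gg ->]]; exists g => //; rewrite E.
Qed.

Lemma g2_orbit_null p : g2_orbit v1 v2 p -> null_point p.
Proof.
case/g2_orbitP => g Gg ->; have [f00 f01 f11 n01] := form_hw.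
(* The coordinate [c] of [u1] along [e] produces the [V_7] component: [u0 /\ u1] is [d] times the
   translate of [w01], plus [c (g r0) /\ e]. *)
pose u0 : 'rV[F]_(7 + 1) := row_mx (r0 *m g^T) 0.
pose u1 : 'rV[F]_(7 + 1) := row_mx (d *: (r1 *m g^T)) c%:M.
have [f00g _] := g2_group_preserves Gg r0 r0.
have [f11g _] := g2_group_preserves Gg r1 r1.
have [f01g n01g] := g2_group_preserves Gg r0 r1.
exists u0, u1; split.
  split; rewrite ?form8_bil /null8 ?row_mxKl.
  - by rewrite f00g.
  - by rewrite linearZ -scalemxAr mxE f01g f01 mulr0.
  - by rewrite -[LHS]/(bil _ _ _) bilZl bilZr /bil f11g f11 !mulr0.
  - rewrite scalemxAl; have [_ ->] := g2_group_preserves Gg r0 (d *: r1).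
    by rewrite wedgeZr cross7Z n01 scaler0 mul0mx.
have e1 : (c%:M : 'M[F]_1) 0 0 = c by rewrite mxE.
have e2 : (0 : 'M[F]_1) 0 0 = 0 by rewrite mxE.
rewrite bivector_of_pointK wedge8E !row_mxKl !row_mxKr e1 e2 scale0r subr0.
by rewrite wedgeZr wedge_mul trmxK.
Qed.

Definition action_mx (h : 'M[F]_7) : 'M[F]_(7 + 7 * 7) :=
  block_mx h^T 0 0 (lin_mx (mulmx h \o mulmxr (invmx h))).

Lemma action_mxE h v w : g2_group h -> point v w *m action_mx h = point (v *m h^T) (h *m w *m h^T).
Proof.
move=> Gh; rewrite /point mul_row_block !mulmx0 addr0 add0r mul_vec_lin /=.
by rewrite mulmxA g2_group_conj.
Qed.

Lemma base_point_closure s t : (s != 0) || (t != 0) ->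
  zariski_closure (g2_orbit v1 v2) (point (s *: r0) (t *: w01)).
Proof.
have w010 : w01 != 0.
  apply/eqP => /matrixP/(_ (o7 0) (o7 1)); rewrite wedgeE !row7E //= mxE => /eqP.
  by rewrite mulr1 mulr0 subr0 oner_eq0.
have orb s' t' : s' != 0 -> t' != 0 -> g2_orbit v1 v2 (point (s' *: r0) (t' *: w01)).
  move=> s0 t0; apply/g2_orbitP.
  have [||g [Gg r0g w0g]] := @torus F (s' / c) (t' / d); try by rewrite mulf_neq0 ?invr_eq0.
  by exists g; rewrite // r0g w0g !scalerA !mulrA ![_ * s']mulrC ![_ * t']mulrC !mulfK.
move=> st; have p0 : point (s *: r0) (t *: w01) != 0.
  by rewrite point_eq0 !scaler_eq0 (negPf (hw_row_neq0 F)) (negPf w010) !orbF negb_and.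
have pointD v w v' w' : point v w + point v' w' = point (v + v') (w + w').
  by rewrite /point add_row_mx mulmxDl linearD.
have pointZ a v w : a *: point v w = point (a *: v) (a *: w).
  by rewrite /point scale_row_mx -scalemxAl linearZ.
(* The direction is nonzero exactly in the components where [s] or [t] vanishes, so every other
   point of the line has both coefficients nonzero and lies in the orbit. *)
apply: (@closure_line _ _ _ _ (point ((s == 0)%:R *: r0) ((t == 0)%:R *: w01))) => // a a0.
rewrite pointZ pointD !scalerA -!scalerDl; apply: orb.
  by case: (eqVneq s 0) => [->|s0]; rewrite ?mulr1 ?add0r // mulr0 addr0.
by case: (eqVneq t 0) => [->|t0]; rewrite ?mulr1 ?add0r // mulr0 addr0.
Qed.

Lemma null_point_closure p : p != 0 -> null_point p -> zariski_closure (g2_orbit v1 v2) p.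
Proof.
move=> p0 [u0 [u1 [[q00 q01 q11 null] pE]]].
rewrite !form8_bil in q00 q01 q11; rewrite /null8 in null.
have {}pE : p = point_of_bivector (wedge u0 u1) by rewrite -pE point_of_bivectorK.
move: pE; rewrite wedge8E -bivector_of_pointK point_of_bivectorK.
move: (lsubmx u0) (lsubmx u1) (rsubmx u0 0 0) (rsubmx u1 0 0) q00 q01 q11 null.
move=> x0 x1 a0 a1 q00 q01 q11 null pE.
have q10 : form x1 x0 = 0.
  by rewrite -[LHS]/(bil _ _ _) bilC ?form7_sym.
(* The combination [a1 u0 - a0 u1] has no component along [e], and its [V_7] part is the [V_7]
   component of [p]. When nonzero it serves as [x], and a suitable [y] restores the same wedge;
   otherwise [s = 0] and any basis will do. *)
have [x [y [s [x_neq0 xx xy pE']]]] : exists x y s,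
    [/\ x != 0, form x x = 0, cross7 (wedge x y) = 0 & p = point (s *: x) (wedge x y)].
  have [v0|v0] := eqVneq (a1 *: x0 - a0 *: x1) 0.
    exists x0, x1, 0; rewrite pE v0 scale0r; split=> //.
    apply: contraNneq p0 => x00; rewrite pE v0 x00 /wedge trmx0 mul0mx mulmx0 subrr.
    by rewrite point00.
  have [y yE] : exists y, wedge (a1 *: x0 - a0 *: x1) y = wedge x0 x1.
    have [a10|a10] := eqVneq a1 0.
      have a00 : a0 != 0 by apply: contraNneq v0 => ->; rewrite a10 !scale0r subrr.
      exists (a0^-1 *: x0); rewrite a10 scale0r sub0r wedgeZr -scaleNr wedgeZl scalerA.
      by rewrite mulrN mulVf // scaleN1r /wedge opprB.
    exists (a1^-1 *: x1); rewrite wedgeZr; apply/matrixP => i j.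
    by rewrite mxE !wedgeE !mxE; field.
  exists (a1 *: x0 - a0 *: x1), y, 1; rewrite yE scale1r; split=> //.
  rewrite -[LHS]/(bil _ _ _) !(bilDl, bilDr, bilNl, bilNr, bilZl, bilZr).
  by rewrite /bil q00 q01 q10 q11; ring.
have [g [Gg [a a0' xg] [b wg]]] := reduce_pair x_neq0 xx xy.
have [h Gh gh] := g2_group_inv Gg; have hg := mulmx1C gh.
have ghT : g^T *m h^T = 1%:M by rewrite -trmx_mul hg trmx1.
have pA : p = point (s * a *: r0) (b *: w01) *m action_mx h.
  rewrite action_mxE // -scalerA -xg -wg pE'; congr point.
    by rewrite -scalemxAl -mulmxA ghT mulmx1.
  by rewrite !mulmxA hg mul1mx -mulmxA ghT mulmx1.
rewrite pA; apply: closure_linear; last by rewrite -pA.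
  move=> q /g2_orbitP[k Gk ->]; apply/g2_orbitP; exists (h *m k); first exact: g2_group_mul.
  by rewrite action_mxE // trmx_mul !mulmxA -!scalemxAl -scalemxAr -!scalemxAl !mulmxA.
apply: base_point_closure; apply: contraNT p0; rewrite negb_or !negbK => /andP[/eqP s0 /eqP t0].
by rewrite pA s0 t0 !scale0r point00 mul0mx.
Qed.

Lemma horosphericalP p : g2_horospherical v1 v2 p <-> p != 0 /\ null_point p.
Proof.
split=> [pX|[p0 Zp]]; last exact: null_point_closure.
by split; [exact: pX.1 | apply: closure_null_point pX; exact: g2_orbit_null].
Qed.

End Horospherical.

(** * The isomorphism *)

Section ZeroLocus.
Variables (F : numClosedFieldType) (B : 'M[F]_9) (hB : nondegenerate_form B).
Variables (gamma : {linear 'rV[F]_9 -> 'M[F]_16}) (hgamma : clifford_action B gamma).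
Variables (K : 'M[F]_16) (hK : invariant_form B gamma K).
Variables (delta : 'cV[F]_16) (hdelta0 : delta != 0).
Hypotheses (hdeltaQ : in_quadric K delta) (hdelta : ~ pure_spinor B gamma delta).

Let g (v : 'rV[F]_9) : 'M[F]_16 := gamma v.

Lemma zero_locusP : exists2 T : 'M[F]_(7 + 1, 9), row_free T &
  forall p, zero_locus B gamma delta p <-> exists u0 u1,
    [/\ wedge u0 u1 != 0, null_plane u0 u1 & p = mxvec (T^T *m wedge u0 u1 *m T)].
Proof.
have [symB uB] := hB; have [symK K0 spinK] := hK.
have gD u v : g (u + v) = g u + g v by exact: linearD.
have gZ c u : g (c *: u) = c *: g u by exact: linearZ.
have gE v : g v *m g v = (bil B v v)%:M by exact: hgamma.
have spin2K u v : bil B u u = 1 -> bil B v v = 1 ->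
    (g u *m g v)^T *m K *m (g u *m g v) = K.
  move=> uu vv; apply: spinK; exists [:: u; v]; split=> // [x|].
    by rewrite !inE => /orP[]/eqP->.
  by rewrite !big_cons big_nil mulmx1.
have dQ : bil K delta^T delta^T = 0 by rewrite /bil trmxK.
have [|e [e' [b wf]]] := exists_weight_frame symB uB gD gZ gE hdelta0 symK K0 spin2K dQ.
  by case=> E [freeE isoE EP]; apply: hdelta; split=> //; exists E.
have freeT := row_free_frame8 wf.
exists (frame8 e b) => // p.
have clifford_imageP (U : 'M[F]_(2, 9)) : row_free U -> U *m B *m U^T = 0 ->
    clifford_image gamma U delta <-> g (row 0 U) *m (g (row 1 U) *m delta) = 0.
  exact: (mem_clifford_image symB uB gD gE delta).
have planeP := annihilated_plane symB gD gZ gE wf.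
have wedgeT (U : 'M[F]_(2, 7 + 1)) : wedge (row 0 (U *m frame8 e b)) (row 1 (U *m frame8 e b)) =
    (frame8 e b)^T *m wedge (row 0 U) (row 1 U) *m frame8 e b.
  by rewrite !row_mul wedge_mul.
split=> [[U [[freeU isoU] dU ->]]|[u0 [u1 [w0 [q00 q01 q11 null] ->]]]].
  have /planeP[U8 [UE freeU8 isoU8 null]] :
      [/\ row_free U, U *m B *m U^T = 0 & g (row 0 U) *m (g (row 1 U) *m delta) = 0].
    by split=> //; apply/clifford_imageP.
  exists (row 0 U8), (row 1 U8); split; first by rewrite -row_free2.
    by split=> //; rewrite -mulmx_bil isoU8 mxE.
  by rewrite -wedgeT -UE.
pose U8 : 'M[F]_(2, 7 + 1) := \matrix_i (if i == 0 then u0 else u1).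
have [r0 r1] : row 0 U8 = u0 /\ row 1 U8 = u1 by rewrite !rowK.
have symS : (form8 F)^T = form8 F by rewrite /form8 tr_block_mx form7_sym !trmx0.
have /planeP[freeU isoU dU] : exists U8' : 'M[F]_(2, 7 + 1),
    [/\ U8 *m frame8 e b = U8' *m frame8 e b, row_free U8',
      U8' *m form8 F *m U8'^T = 0 & null8 (row 0 U8') (row 1 U8')].
  exists U8; split=> //; rewrite ?row_free2 ?r0 ?r1 //.
  apply/matrixP => i j; rewrite mulmx_bil mxE; elim/ord2P: i; elim/ord2P: j;
    by rewrite ?r0 ?r1 // bilC.
exists (U8 *m frame8 e b); split=> //; first exact/clifford_imageP.
by rewrite /plucker -/(wedge _ _) wedgeT r0 r1.
Qed.

Lemma zero_locus_isomorphic (v1 : 'cV[F]_7) (v2 : 'M[F]_7) :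
  hw_vector_V7 v1 -> hw_vector_g2 v2 ->
  proj_isomorphic (zero_locus B gamma delta) (g2_horospherical v1 v2).
Proof.
case/hw_vector_V7P => c c0 -> /hw_vector_g2P[d d0 ->].
have [T freeT XP] := zero_locusP; have YP := horosphericalP c0 d0.
pose T' := pinvmx T; have TT' : T *m T' = 1%:M by exact: mulmxVp. clearbody T'.
(* The right inverse [T'] lets [f] undo [h]; conversely [h] undoes [f] on bivectors coming from
   [u0 /\ u1] through [T], which include all points of the zero locus. *)
pose f (p : 'rV[F]_(9 * 9)) := point_of_bivector (T'^T *m vec_mx p *m T').
pose h (q : 'rV[F]_(7 + 7 * 7)) := mxvec (T^T *m bivector_of_point q *m T).
have T'T u0 u1 : T'^T *m (T^T *m wedge u0 u1 *m T) *m T' = wedge u0 u1.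
  by rewrite !mulmxA -trmx_mul TT' trmx1 mul1mx -mulmxA TT' mulmx1.
have fE u0 u1 : f (mxvec (T^T *m wedge u0 u1 *m T)) = point_of_bivector (wedge u0 u1).
  by rewrite /f mxvecK T'T.
have pbK u0 u1 : bivector_of_point (point_of_bivector (wedge u0 u1)) = wedge u0 u1.
  by rewrite {1}wedge8E -bivector_of_pointK point_of_bivectorK bivector_of_pointK -wedge8E.
have hf x : zero_locus B gamma delta x -> h (f x) = x.
  by case/XP => u0 [u1 [_ _ ->]]; rewrite fE /h pbK.
pose Y := g2_horospherical (c *: hw_row F)^T (d *: (hw_bivector F *m form7 F)).
have fX x : zero_locus B gamma delta x -> Y (f x).
  case/XP => u0 [u1 [w0 n01 ->]]; apply/YP; rewrite fE; split.
    apply: contraNneq w0 => fx0; rewrite -pbK fx0.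
    by rewrite -point00 bivector_of_pointK bivector8_eq0 !eqxx.
  by exists u0, u1; split; rewrite ?pbK.
have fh y : Y y -> f (h y) = y.
  by case/YP => y0 [u0 [u1 [_ yE]]]; rewrite /h yE fE -yE point_of_bivectorK.
have hY y : Y y -> zero_locus B gamma delta (h y).
  case/YP => y0 [u0 [u1 [n01 yE]]]; apply/XP; exists u0, u1; split=> //; last by rewrite /h yE.
  apply: contraNneq y0 => w0; rewrite -[y]point_of_bivectorK yE w0.
  by rewrite point_of_bivector0.
have lf : is_linear f.
  move=> a x y; rewrite /f linearD linearZ /= mulmxDr mulmxDl -scalemxAr -scalemxAl.
  exact: point_of_bivector_linear.
have lh : is_linear h.
  move=> a x y; rewrite /h.
  have -> : bivector_of_point (a *: x + y) = a *: bivector_of_point x + bivector_of_point y.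
    rewrite /bivector_of_point /bivector8 !linearD !linearZ /= scale_block_mx add_block_mx.
    by rewrite mulmxDl -scalemxAl scaler0 addr0.
  by rewrite mulmxDr mulmxDl -scalemxAr -scalemxAl linearD linearZ.
exists f, h; split.
- apply: linear_morphism => // x /fX/YP[]//.
- apply: linear_morphism => // y Yy; apply: contraTneq isT => hy0.
  have := fh y Yy; case/YP: Yy => y0 _ yE; case/eqP: y0; rewrite -yE hy0.
  by have := lf (- 1) 0 0; rewrite scaler0 add0r scaleN1r addNr.
- by move=> x Xx; exists 1; rewrite ?oner_eq0 // hf // scale1r.
- by move=> y Yy; exists 1; rewrite ?oner_eq0 // fh // scale1r.
Qed.

End ZeroLocus.

Theorem proposition8 (R : realType)
    (B : 'M[R[i]]_9) (hB : nondegenerate_form B)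
    (gamma : {linear 'rV[R[i]]_9 -> 'M[R[i]]_16}) (hgamma : clifford_action B gamma)
    (K : 'M[R[i]]_16) (hK : invariant_form B gamma K)
    (v1 : 'cV[R[i]]_7) (hv1 : hw_vector_V7 v1)
    (v2 : 'M[R[i]]_7) (hv2 : hw_vector_g2 v2)
    (delta : 'cV[R[i]]_16) (hdelta0 : delta != 0)
    (hdeltaQ : in_quadric K delta) (hdelta : ~ pure_spinor B gamma delta) :
  proj_isomorphic (zero_locus B gamma delta) (g2_horospherical v1 v2).
Proof. exact: (zero_locus_isomorphic hB hgamma hK hdelta0 hdeltaQ hdelta hv1 hv2). Qed.
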